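(* Let $0<R<\infty$, and let $\mu$ be a pseudo-positive signed measure with support in the closed ball $B_R=\{x\in\mathbb{R}^d:|x|\le R\}$ such that $$\sum_{k=0}^{\infty}\sum_{l=1}^{a_k}\int_{\mathbb{R}^d}Y_{k,l}\Big(\frac{x}{|x|}\Big)\,d\mu(x)<\infty .$$ For each natural number $s\ge1$ let $\sigma^{(s)}$ be the polyharmonic Gauß–Jacobi measure of order $s$ for $\mu$. Then $$\int f\,d\sigma^{(s)}\to\int f\,d\mu\qquad\text{as } s\to\infty$$ for every continuous function $f:B_R\to\mathbb{C}$.
   Context: Fix an integer $d\ge 2$. $|x|$ is the Euclidean norm, $\Delta$ the Laplace operator on $\mathbb{R}^d$, and $\mathbb{S}^{d-1}$ the unit sphere with surface measure $d\theta$. For each $k\in\mathbb{N}_0=\{0,1,2,\dots\}$, $Y_{k,1},\dots,Y_{k,a_k}:\mathbb{R}^d\to\mathbb{R}$ is a fixed basis of the space of harmonic homogeneous polynomials of degree $k$, orthonormal with respect to $\langle f,g\rangle=\int_{\mathbb{S}^{d-1}}f(\theta)\overline{g(\theta)}\,d\theta$. At $x=0$, $Y_{k,l}(x/|x|)$ is read as $0$ for $k\ge1$ and as the constant value of $Y_{0,1}$ for $k=0$. A signed measure on $\mathbb{R}^d$ is a real-valued $\sigma$-additive set function on the Borel sets. It is pseudo-positive if $\int_{\mathbb{R}^d}h(|x|)Y_{k,l}(x)\,d\mu(x)\ge0$ for every continuous compactly supported $h:[0,\infty)\to[0,\infty)$ and all $k,l$. The component measures of a compactly supported pseudo-positive measure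 $\mu$ are the unique non-negative measures $\mu_{k,l}$ on $[0,\infty)$ such that $\int_0^\infty h\,d\mu_{k,l}=\int_{\mathbb{R}^d}h(|x|)Y_{k,l}(x)\,d\mu(x)$ for all continuous polynomially bounded $h:[0,\infty)\to\mathbb{C}$. For $\mu$ as in the claim, the polyharmonic Gauß–Jacobi measure of order $s$ is the (existing and unique) pseudo-positive signed measure $\sigma^{(s)}$ with support in $B_R$ such that (i) each component measure $\sigma^{(s)}_{k,l}$ has support of cardinality $\le s$, and (ii) $\int P\,d\mu=\int P\,d\sigma^{(s)}$ for all polynomials $P$ with $\Delta^{2s}P=0$. *)

(* Defs.v *)
From HB Require Import structures.
From mathcomp Require Import all_boot all_order all_algebra.
From mathcomp Require Import all_classical all_reals all_analysis.
From mathcomp Require mpoly.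
(* the notations of mpoly clash with those of MathComp-Analysis *)
Import (canonicals, coercions) mpoly.
From mathcomp Require Import complex.

Set Implicit Arguments.
Unset Strict Implicit.
Unset Printing Implicit Defensive.

Import Order.TTheory GRing.Theory Num.Theory.
Import numFieldNormedType.Exports.

Local Open Scope classical_set_scope.
Local Open Scope ring_scope.
Local Open Scope complex_scope.

Section SignedMeasureIntegral.
Context {disp : measure_display} {T : measurableType disp} {R : realType}.
Implicit Types (nu : {charge set T -> \bar R}) (D : set T).

Lemma hahn_pair_ex nu :
  exists PN : set T * set T, hahn_decomposition nu PN.1 PN.2.
Proof. by have [P [N PN]] := Hahn_decomposition nu; exists (P, N). Qed.

Definition hahn_pair nu := projT1 (cid (hahn_pair_ex nu)).

Definition hahn_pairP nu : hahn_decomposition nu (hahn_pair nu).1 (hahn_pair nu).2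
  := projT2 (cid (hahn_pair_ex nu)).

(* The integral against nu = nu+ - nu- (Jordan decomposition, which does not
   depend on the Hahn decomposition that is chosen).  All integrands below are
   measurable and bounded nu-almost everywhere, so both terms are genuine finite
   integrals. *)
Definition signed_integral nu D (f : T -> R) : R :=
  Rintegral (jordan_pos (hahn_pairP nu)) D f
  - Rintegral (jordan_neg (hahn_pairP nu)) D f.

End SignedMeasureIntegral.

Definition complex_integral {T : Type} {R : realType}
    (I : (T -> R) -> R) (f : T -> R[i]) : R[i] :=
  I (fun x => complex.Re (f x)) +i* I (fun x => complex.Im (f x)).

(* The complement of the largest open set all of whose Borel subsets are null:
   for a signed measure this is the support of its total variation. *)
Definition measure_support {T : topologicalType} {R : realType}
    (nu : set T -> \bar R) : set T :=
  [set x | forall U : set T, open U -> U x ->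
     exists A : set T, [/\ <<s @open T >> A, A `<=` U & nu A <> 0%E]].

Notation borel_rV R d := (g_sigma_algebraType (@open 'rV[R]_d)).

Definition enorm {R : realType} {d : nat} (x : 'rV[R]_d) : R :=
  Num.sqrt (\sum_(i < d) x ord0 i ^+ 2).

Definition eball {R : realType} {d : nat} (r : R) : set 'rV[R]_d :=
  [set x | enorm x <= r].

Definition esphere {R : realType} {d : nat} : set 'rV[R]_d :=
  [set x | enorm x = 1].

(* x / |x|; this is 0 at x = 0, so that there a homogeneous polynomial of
   degree k evaluates to 0 if k >= 1, and to its constant value if k = 0. *)
Definition direction {R : realType} {d : nat} (x : 'rV[R]_d) : 'rV[R]_d :=
  (enorm x)^-1 *: x.

(* The n-fold product of the Lebesgue measure of the line. *)
Fixpoint lebesgue_rV (R : realType) (n : nat) : set (borel_rV R n) -> \bar R :=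
  match n return set (borel_rV R n) -> \bar R with
  | 0%N => fun A => dirac (0 : borel_rV R 0) A
  | m.+1 => fun A =>
      (lebesgue_measure \x lebesgue_rV (R := R) (n := m))%E
        [set p | A (row_mx (p.1 : R)%:M (p.2 : 'rV[R]_m) : 'rV[R]_(1 + m))]
  end.

(* Surface measure of the unit sphere (concentrated on esphere): the area of A
   is d times the volume of the cone {t *: theta | theta \in A, 0 < t <= 1}. *)
Definition surface_measure (R : realType) (d : nat) (A : set (borel_rV R d)) :
    \bar R :=
  (d%:R%:E * lebesgue_rV
     [set x : 'rV[R]_d | [/\ (0 < enorm x)%R, (enorm x <= 1)%R & A (direction x)]])%E.

Definition peval {R : realType} {d : nat} (P : mpoly.mpoly d R) (x : 'rV[R]_d) :
    R :=
  mpoly.meval (fun i => x ord0 i) P.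

Definition cpeval {R : realType} {d : nat} (P : mpoly.mpoly d R[i])
    (x : 'rV[R]_d) : R[i] :=
  mpoly.meval (fun i => (x ord0 i)%:C) P.

Definition laplacian {K : nzRingType} {d : nat} (P : mpoly.mpoly d K) :
    mpoly.mpoly d K :=
  \sum_(i < d) mpoly.mderiv i (mpoly.mderiv i P).

Definition solid_harmonic {K : nzRingType} {d : nat} (k : nat)
    (P : mpoly.mpoly d K) : Prop :=
  P \is mpoly.ishomog1 k mpoly.mdeg /\ laplacian P = 0.

Section PseudoPositive.
Context {R : realType} {d : nat} {a : nat -> nat}.
Variable Y : forall k : nat, 'I_(a k) -> mpoly.mpoly d R.
Implicit Types mu sigma : {charge set (borel_rV R d) -> \bar R}.

(* The Y k l are real, so no conjugation is needed in the inner product. *)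
Definition orthonormal_harmonic_basis : Prop :=
  forall k : nat,
    [/\ forall l : 'I_(a k), solid_harmonic k (Y l),
        forall P : mpoly.mpoly d R, solid_harmonic k P ->
          exists! c : 'rV[R]_(a k), P = \sum_(l < a k) c ord0 l *: Y l
      & forall l l' : 'I_(a k),
          (\int[@surface_measure R d]_(x in esphere)
             (peval (Y l) x * peval (Y l') x)%:E = (l == l')%:R%:E)%E].

Definition pseudo_positive mu : Prop :=
  forall h : R -> R,
    {within `[0, +oo[, continuous h} ->
    (forall t, 0 <= t -> 0 <= h t) ->
    (exists M : R, forall t, M < t -> h t = 0) ->
    forall (k : nat) (l : 'I_(a k)),
      0 <= signed_integral mu setT (fun x => h (enorm x) * peval (Y l) x).

Definition polynomially_bounded (h : R -> R[i]^o) : Prop :=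
  exists (C : R) (m : nat), forall t, 0 <= t -> `|h t| <= (C * (1 + t ^+ m))%:C.

(* A measure on [0, +oo[ is encoded as a Borel measure on the line that
   vanishes on ]-oo, 0[. *)
Definition component_measure mu (k : nat) (l : 'I_(a k))
    (nu : {measure set (measurableTypeR R) -> \bar R}) : Prop :=
  nu [set t : R | t < 0] = 0%E /\
  forall h : R -> R[i]^o,
    {within `[0, +oo[, continuous h} -> polynomially_bounded h ->
    [/\ nu.-integrable [set t : R | 0 <= t] (fun t => (complex.Re (h t))%:E),
        nu.-integrable [set t : R | 0 <= t] (fun t => (complex.Im (h t))%:E)
      & complex_integral (Rintegral nu [set t : R | 0 <= t]) h =
        complex_integral (signed_integral mu setT)
          (fun x => h (enorm x) * (peval (Y l) x)%:C)].

Definition gauss_jacobi (r : R) mu (s : nat) sigma : Prop :=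
  [/\ pseudo_positive sigma,
      measure_support sigma `<=` eball r,
      (forall (k : nat) (l : 'I_(a k)),
        exists nu : {measure set (measurableTypeR R) -> \bar R},
          component_measure sigma l nu /\
          (measure_support (nu : set R -> \bar R) #<= `I_s)%card)
    & forall P : mpoly.mpoly d R[i], iter (2 * s) laplacian P = 0 ->
        complex_integral (signed_integral mu setT) (cpeval P) =
        complex_integral (signed_integral sigma setT) (cpeval P)].

End PseudoPositive.

(* Main.v *)
(* The total masses of the sigma s need not be controlled directly: it is enough
   to bound the integral of P against sigma s by C max |P| for all polynomials P,
   with C independent of s, since every P has the same integral against mu and
   sigma s for large s and polynomials are dense in C(B_r).

   By Almansi's theorem P is a finite sum of p_kl(|x|^2) Y_kl(x).  The coefficient
   p_kl(t^2) t^k is a Fourier coefficient of P on the sphere of radius t, hence is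
   at most a constant times max |P|.  The component measure of sigma s has at most
   s nodes; let q be the Hermite interpolation polynomial of u |-> u^(-k/2) at their
   squares, of degree < 2s.  As the function is completely monotone, q lies below
   it, so the integral of p_kl(|x|^2) Y_kl against sigma s is at most C max |P| times
   the integral of q(|x|^2) Y_kl against sigma s, which equals the one against mu
   and is at most the integral of Y_kl(x/|x|) against mu.  These are summable. *)

(* A bound that is uniform in s and known only for polynomials still suffices: each sigma s has some
   finite total variation, so a continuous integrand may be replaced by a polynomial whose error is
   chosen after s, small against that variation. The variation then disappears from the estimate.

   The Fourier coefficients need orthogonality of harmonics of different degrees, while
   orthonormality is given within each degree only. It is derived from Green's identity on the ball,
   with a weight that vanishes on the unit sphere, so that no boundary integral occurs. Since the
   surface measure is defined through cones, spherical integrals are integrals of functions of x/|x|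
   over the punctured ball. Powers of 1/|x| are reached there as limits of polynomials in |x|^2; the
   same polynomials yield the approximation of absolute values behind the density theorem.

   The power u^(-k/2) is singular at 0, so for k > 0 it must be shown that no node with positive
   weight sits at 0. This comes from Y_kl vanishing at the origin. *)
Require Import Defs.
From HB Require Import structures.
From mathcomp Require Import all_boot all_order all_algebra.
From mathcomp Require Import all_classical all_reals all_analysis.
From mathcomp Require mpoly.
Import (canonicals, coercions) mpoly.
From mathcomp Require Import complex.
From mathcomp Require Import measurable_realfun.
From mathcomp Require Import ring lra zify.
Set Implicit Arguments.
Unset Strict Implicit.
Unset Printing Implicit Defensive.
Import Order.TTheory GRing.Theory Num.Theory.
Import numFieldNormedType.Exports.
Local Open Scope classical_set_scope.
Local Open Scope ring_scope.

(** * Interpolating a negative power from below *)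

Section ReciprocalCone.
Variable R : realFieldType.

(* Completely monotone functions of t ^+ 2 that are stable under taking
   divided differences in the variable t ^+ 2. *)
Inductive reciprocal_cone : (R -> R) -> Prop :=
| reciprocal_cone1 : reciprocal_cone (fun=> 1)
| reciprocal_coneD g h : reciprocal_cone g -> reciprocal_cone h ->
    reciprocal_cone (fun t => g t + h t)
| reciprocal_coneZ c g : 0 <= c -> reciprocal_cone g ->
    reciprocal_cone (fun t => c * g t)
| reciprocal_coneM a g : 0 <= a -> reciprocal_cone g ->
    reciprocal_cone (fun t => g t / (t + a)).

Lemma reciprocal_cone_ge0 g : reciprocal_cone g -> forall t, 0 < t -> 0 <= g t.
Proof.
elim=> // {g} [g h _ IHg _ IHh|c g c0 _ IHg|a g a0 _ IHg] t t0.
- by rewrite addr_ge0 ?IHg ?IHh.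
- by rewrite mulr_ge0 ?IHg.
- by apply: divr_ge0; [exact: IHg | rewrite addr_ge0// ltW].
Qed.

Lemma reciprocal_cone_exprVn k : reciprocal_cone (fun t => t ^- k).
Proof.
elim: k => [|k IHk].
  have -> : (fun t : R => t ^- 0) = fun=> 1 by apply/funext => t; rewrite expr0 invr1.
  exact: reciprocal_cone1.
have -> : (fun t : R => t ^- k.+1) = fun t => t ^- k / (t + 0).
  by apply/funext => t; rewrite addr0 exprSr invfM mulrC.
exact: reciprocal_coneM.
Qed.

(** The generating case is 1/(t + a) - 1/(v + a) = (v^2 - t^2) / ((v + a) (t + v) (t + a)): passing
    to the variable t^2 costs a factor 1/(t + v). This is why the cone admits every shift [a] and
    not just the powers t^-k. *)
Lemma reciprocal_cone_divided_difference g v : reciprocal_cone g -> 0 < v ->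
  exists2 h, reciprocal_cone h &
    forall t, 0 < t -> g t = g v + (v ^+ 2 - t ^+ 2) * h t.
Proof.
move=> Cg v0; have z0 : reciprocal_cone (fun=> 0 : R).
  have := reciprocal_coneZ (lexx (0:R)) reciprocal_cone1.
  by under eq_fun do rewrite mul0r.
elim: Cg => {g} [|g h Cg [g' Cg' Eg] Ch [h' Ch' Eh]|c g c0 Cg [g' Cg' Eg]
  |a g a0 Cg [g' Cg' Eg]].
- by exists (fun=> 0) => // t _; rewrite mulr0 addr0.
- exists (fun t => g' t + h' t); first exact: reciprocal_coneD.
  by move=> t t0; rewrite Eg// Eh//; ring.
- exists (fun t => c * g' t); first exact: reciprocal_coneZ.
  by move=> t t0; rewrite Eg//; ring.
- exists (fun t => g' t / (t + a) + g v / (v + a) * (1 / (t + v) / (t + a))).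
    apply: reciprocal_coneD; first exact: reciprocal_coneM.
    apply: reciprocal_coneZ.
      by rewrite divr_ge0 ?(reciprocal_cone_ge0 Cg)// addr_ge0// ltW.
    apply: reciprocal_coneM => //; apply: reciprocal_coneM; first exact: ltW.
    exact: reciprocal_cone1.
  move=> t t0; rewrite Eg//; field.
  by rewrite !gt_eqF// ?ltr_wpDr// ltW.
Qed.

(** Newton's interpolation formula, by iterated divided differences. The entries of [vs] may repeat,
    so Hermite interpolation is included without any derivative. *)
Lemma reciprocal_cone_newton g (vs : seq R) :
    reciprocal_cone g -> all (fun v => 0 < v) vs ->
  exists2 q : {poly R}, (size q <= size vs)%N &
  exists2 h, reciprocal_cone h & forall t, 0 < t ->
    g t = q.[t ^+ 2] + \prod_(v <- vs) (v ^+ 2 - t ^+ 2) * h t.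
Proof.
elim: vs g => [|v vs IH] g Cg /=.
  exists 0; rewrite ?size_poly0//; exists g => // t _.
  by rewrite horner0 big_nil add0r mul1r.
move=> /andP[v0 vs0]; have [g1 Cg1 Eg] := reciprocal_cone_divided_difference Cg v0.
have [q sq [h Ch Eg1]] := IH _ Cg1 vs0.
exists ((g v)%:P + ((v ^+ 2)%:P - 'X) * q).
  apply: (leq_trans (size_polyD _ _)); rewrite geq_max.
  rewrite (leq_trans (size_polyC_leq1 _))//=.
  apply: (leq_trans (size_polyMleq _ _)); rewrite -opprB size_polyN size_XsubC.
  exact: sq.
exists h => // t t0; rewrite Eg// Eg1// big_cons !hornerE; ring.
Qed.

(* With every node doubled, the Newton remainder is a square times a
   nonnegative function. *)
Lemma exprVn_lower_interpolation k (vs : seq R) : all (fun v => 0 < v) vs ->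
  exists q : {poly R}, [/\ (size q <= 2 * size vs)%N,
    forall t, 0 < t -> q.[t ^+ 2] <= t ^- k
  & forall t, t \in vs -> q.[t ^+ 2] = t ^- k].
Proof.
move=> vs0; have vvs0 : all (fun v => 0 < v) (vs ++ vs) by rewrite all_cat vs0.
have [q sq [h Ch Eq]] :=
  reciprocal_cone_newton (reciprocal_cone_exprVn k) vvs0.
exists q; split; first by rewrite mul2n -addnn -size_cat.
  move=> t t0; rewrite Eq// lerDl big_cat/= -expr2.
  by rewrite mulr_ge0 ?sqr_ge0// (reciprocal_cone_ge0 Ch).
move=> t tvs; have t0 := allP vs0 _ tvs.
by rewrite Eq// big_cat (big_rem t tvs)/= subrr !mul0r addr0.
Qed.

End ReciprocalCone.

(** * Polyharmonic polynomials and the Almansi expansion *)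

Section PolynomialAlgebra.
Variables (K : comNzRingType) (d : nat).
Local Notation mp := (mpoly.mpoly d K).
Local Notation X i := (mpoly.mpolyX K (mpoly.mnm1 (n := d) i)).
Local Notation D i := (mpoly.mderiv (n := d) (R := K) i).
Implicit Types P Q H : mp.

Lemma mpoly_ring_ind (S : mp -> Prop) :
  (forall c, S (mpoly.mpolyC d c)) -> (forall i, S (X i)) ->
  (forall P Q, S P -> S Q -> S (P + Q)) ->
  (forall P Q, S P -> S Q -> S (P * Q)) -> forall P, S P.
Proof.
move=> SC SX SD SM; elim/mpoly.mpolyind => [|c m p _ _ Sp].
  by rewrite -(mpoly.mpolyC0 d K); exact: SC.
apply: SD => //; rewrite -mpoly.mul_mpolyC; apply: (SM _ _ (SC c)).
rewrite mpoly.mpolyXE_id; apply: (big_ind S) => [|x y Sx Sy|]; [exact: (SC 1)|exact: SM|].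
move=> i _; elim: (m i) => [|n IHn]; first by rewrite expr0; exact: (SC 1).
by rewrite exprS; exact: SM.
Qed.

Lemma euler_identity k P : P \is mpoly.ishomog1 k mpoly.mdeg ->
  \sum_(i < d) X i * D i P = P *+ k.
Proof.
move=> /mpoly.dhomogP hP; rewrite {2}[P]mpoly.mpolyE -sumrMnl.
under eq_bigr => i _ do rewrite {1}[P]mpoly.mpolyE raddf_sum mulr_sumr.
rewrite exchange_big /= big_seq [RHS]big_seq; apply: eq_bigr => m mP.
rewrite -(hP _ mP) /= mpoly.mdegE -sumrMnr; apply: eq_bigr => i _.
rewrite mpoly.mderivZ mpoly.mderivX -!scalerAr -mpoly.mpolyXD.
case: (posnP (m i)) => [->|mi]; first by rewrite scale0r scaler0 mulr0n.
rewrite scaler_nat -scalerMnr; congr ((_ *: mpoly.mpolyX _ _) *+ _).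
apply/mpoly.mnmP => j; rewrite mpoly.mnmDE mpoly.mnmBE mpoly.mnm1E.
by case: eqVneq => [<-|_] /=; rewrite ?subn0 ?add0n// subnKC.
Qed.

Lemma mderiv_homog k i P : P \is mpoly.ishomog1 k mpoly.mdeg ->
  D i P \is mpoly.ishomog1 k.-1 mpoly.mdeg.
Proof.
move=> hP; apply/mpoly.dhomogP => m; rewrite mpoly.mcoeff_msupp.
rewrite mpoly.mcoeff_mderiv => nz.
have : mpoly.mcoeff (mpoly.mnm_add m (mpoly.mnm1 i)) P != 0.
  by apply: contraNneq nz => ->; rewrite mul0rn.
rewrite -mpoly.mcoeff_msupp => /(mpoly.dhomog_mf hP) /=.
by rewrite mpoly.mdegD mpoly.mdeg1 addn1 => <-.
Qed.

Lemma mderiv_homog0 i P : P \is mpoly.ishomog1 0%N mpoly.mdeg -> D i P = 0.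
Proof.
move=> hP; apply/mpoly.mpolyP => m; rewrite mpoly.mcoeff_mderiv mpoly.mcoeff0.
rewrite (mpoly.dhomog_nemf_coeff hP) ?mul0rn//=.
by rewrite mpoly.mdegD mpoly.mdeg1 addn1.
Qed.

Lemma laplacianD P Q : laplacian (P + Q) = laplacian P + laplacian Q.
Proof.
rewrite /laplacian -big_split; apply: eq_bigr => i _ /=.
by rewrite !mpoly.mderivD.
Qed.

Lemma laplacianZ c P : laplacian (c *: P) = c *: laplacian P.
Proof.
rewrite /laplacian scaler_sumr; apply: eq_bigr => i _.
by rewrite !mpoly.mderivZ.
Qed.

Lemma laplacian0 : laplacian (0 : mp) = 0.
Proof. by have := laplacianZ 0 0; rewrite !scale0r. Qed.

Lemma iter_laplacianD n P Q :
  iter n laplacian (P + Q) = iter n laplacian P + iter n laplacian Q.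
Proof. by elim: n => //= n ->; rewrite laplacianD. Qed.

Lemma iter_laplacianZ n c P :
  iter n laplacian (c *: P) = c *: iter n laplacian P.
Proof. by elim: n => //= n ->; rewrite laplacianZ. Qed.

Lemma iter_laplacian0 n : iter n laplacian (0 : mp) = 0.
Proof. by elim: n => //= n ->; rewrite laplacian0. Qed.

(** The subtraction is truncated. For [k < 2] this is harmless, since the Laplacian is then 0, which
    is homogeneous of every degree. *)
Lemma laplacian_homog k P : P \is mpoly.ishomog1 k mpoly.mdeg ->
  laplacian P \is mpoly.ishomog1 (k - 2)%N mpoly.mdeg.
Proof.
move=> hP; apply: rpred_sum => i _; rewrite subn2.
by do 2 apply: mderiv_homog.
Qed.

Lemma laplacian_homog_lt2 k P : P \is mpoly.ishomog1 k mpoly.mdeg ->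
  (k < 2)%N -> laplacian P = 0.
Proof.
move=> hP k2; apply: big1 => i _; apply: mderiv_homog0.
by have := mderiv_homog i hP; case: k k2 {hP} => [|[]].
Qed.

Lemma iter_laplacian_homog k n P : P \is mpoly.ishomog1 k mpoly.mdeg ->
  iter n laplacian P \is mpoly.ishomog1 (k - 2 * n)%N mpoly.mdeg.
Proof.
move=> hP; elim: n => [|n IHn] /=; first by rewrite subn0.
by rewrite mulnS addnC subnDA; exact: laplacian_homog.
Qed.

Lemma iter_laplacian_homog_lt k n P : P \is mpoly.ishomog1 k mpoly.mdeg ->
  (k < 2 * n)%N -> iter n laplacian P = 0.
Proof.
move=> hP; case: n => // n kn; rewrite iterS.
by apply: (laplacian_homog_lt2 (iter_laplacian_homog n hP)); lia.
Qed.

Lemma laplacian_nilpotent P : exists n, iter n laplacian P = 0.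
Proof.
(* This number exceeds the degree of every monomial of P, and each Laplacian lowers degrees by 2. *)
exists (mpoly.mmeasure mpoly.mdeg P).
set n := mpoly.mmeasure _ _; rewrite (mpoly.mpolyE P).
have lapX (s : seq (mpoly.multinom d)) : {subset s <= mpoly.msupp P} ->
  iter n laplacian (\sum_(m <- s) mpoly.mcoeff m P *: mpoly.mpolyX K m) = 0.
  elim: s => [|m s IHs] ss; first by rewrite big_nil iter_laplacian0.
  rewrite big_cons iter_laplacianD iter_laplacianZ IHs; last first.
    by move=> x xs; apply: ss; rewrite inE xs orbT.
  rewrite (@iter_laplacian_homog_lt (mpoly.mdeg m)) ?scaler0 ?addr0//.
    by rewrite mpoly.dhomogX.
  apply: (leq_trans (mpoly.msize_mdeg_lt (ss m (mem_head _ _)))).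
  by rewrite mul2n -addnn leq_addr.
exact: lapX.
Qed.

Definition norm_sqr : mp := \sum_(i < d) X i ^+ 2.

Lemma norm_sqr_homog : norm_sqr \is mpoly.ishomog1 2 mpoly.mdeg.
Proof.
apply: rpred_sum => i _; rewrite -(mul1n 2%N).
by apply: mpoly.dhomogMn; rewrite mpoly.dhomogX /= mpoly.mdeg1.
Qed.

Lemma mderivXU i j : D i (X j) = (i == j)%:R.
Proof.
rewrite mpoly.mderivX mpoly.mnm1E eq_sym; case: eqP => [->|_]; last by rewrite scale0r.
rewrite scale1r -[1%:R]/(1 : mp) -mpoly.mpolyX0; congr mpoly.mpolyX.
by apply/mpoly.mnmP => k; rewrite mpoly.mnmBE mpoly.mnm0E subnn.
Qed.

Lemma mderiv_norm_sqr i : D i norm_sqr = X i *+ 2.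
Proof.
rewrite raddf_sum (bigD1 i)//= big1 ?addr0 => [|j ji].
  by rewrite expr2 mpoly.mderivM mderivXU eqxx mul1r mulr1 mulr2n.
by rewrite expr2 mpoly.mderivM mderivXU eq_sym (negPf ji) mul0r mulr0 addr0.
Qed.

(** The product rule gives 2 d P + 4 (x . grad P) + |x|^2 (Laplacian of P), and Euler's identity
    evaluates the middle term. *)
Lemma laplacian_norm_sqrM k P : P \is mpoly.ishomog1 k mpoly.mdeg ->
  laplacian (norm_sqr * P) = P *+ (2 * d + 4 * k) + norm_sqr * laplacian P.
Proof.
move=> hP; have -> : (2 * d + 4 * k = d * 2 + k * 4)%N by lia.
rewrite mulrnDr (mulrnA P k) -(euler_identity hP).
rewrite /laplacian mulr_sumr -sumrMnl.
have -> : P *+ (d * 2) = \sum_(i < d) P *+ 2.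
  by rewrite sumr_const card_ord mulrnAC mulrnA.
rewrite -!big_split; apply: eq_bigr => i _ /=.
rewrite !(mpoly.mderivM, mpoly.mderivD, mderiv_norm_sqr, raddfMn)/= mderivXU eqxx.
suff aux (A : comNzRingType) (p x y n z : A) : (1 + 1) * p + x *+ 2 * y +
    (x *+ 2 * y + n * z) = p *+ 2 + x * y *+ 4 + n * z by exact: aux.
by ring.
Qed.

(* The coefficient is 2 j (2 j + 2 k + d - 2) for j the successor of n. *)
Fixpoint laplacian_coef k n : nat :=
  (2 * d + 4 * (2 * n + k) + if n is n'.+1 then laplacian_coef k n' else 0)%N.

Lemma laplacian_norm_sqrX k n H : solid_harmonic k H ->
  laplacian (norm_sqr ^+ n.+1 * H) = norm_sqr ^+ n * H *+ laplacian_coef k n.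
Proof.
move=> [hH lapH]; elim: n => [|n IHn].
  by rewrite expr1 (laplacian_norm_sqrM hH) lapH mulr0 addr0 expr0 mul1r /= muln0 !addn0.
rewrite exprS -mulrA (@laplacian_norm_sqrM (2 * n.+1 + k)); last first.
  by apply: mpoly.dhomogM => //; apply: mpoly.dhomogMn; exact: norm_sqr_homog.
by rewrite IHn mulrnAr mulrA -exprS -mulrnDr.
Qed.

(** Each Laplacian removes one factor |x|^2. Hence q(|x|^2) H is polyharmonic of order n as soon as
    q has degree less than n, which makes the Hermite polynomials admissible in the moment
    condition. *)
Lemma iter_laplacian_norm_sqrX k j n H : solid_harmonic k H -> (j < n)%N ->
  iter n laplacian (norm_sqr ^+ j * H) = 0.
Proof.
move=> hH; elim: n j => // n IHn [_|j jn].
  by rewrite expr0 mul1r iterSr hH.2 iter_laplacian0.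
rewrite iterSr (laplacian_norm_sqrX _ hH) -scaler_nat iter_laplacianZ IHn//.
by rewrite scaler0.
Qed.

Lemma iter_laplacian_norm_sqrX_diag k j H : solid_harmonic k H ->
  iter j laplacian (norm_sqr ^+ j * H) = H *+ \prod_(i < j) laplacian_coef k i.
Proof.
move=> hH; elim: j => [|j IHj]; first by rewrite expr0 mul1r big_ord0.
rewrite iterSr (laplacian_norm_sqrX _ hH) -scaler_nat iter_laplacianZ IHj.
by rewrite scaler_nat -mulrnA big_ord_recr.
Qed.

End PolynomialAlgebra.
Arguments norm_sqr {K d}.

(* The top coefficient of the Almansi expansion of P is a multiple of the last
   nonzero iterated Laplacian of P. *)
Lemma almansi_ind (K : numFieldType) (d : nat) (S : mpoly.mpoly d K -> Prop) :
  (0 < d)%N -> S 0 -> (forall P Q, S P -> S Q -> S (P + Q)) ->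
  (forall j k H, solid_harmonic k H -> S (norm_sqr ^+ j * H)) ->
  forall P, S P.
Proof.
move=> d0 S0 SD SH.
have homS n m P : P \is mpoly.ishomog1 m mpoly.mdeg ->
    iter n laplacian P = 0 -> S P.
  elim: n P => [P _ /= ->//|n IHn P hP lapP].
  have hH : solid_harmonic (m - 2 * n) (iter n laplacian P).
    by split; [exact: iter_laplacian_homog | exact: lapP].
  (* If [m < 2 * n], the degree [m - 2 * n] is only a truncated one, but then the n-th iterated
     Laplacian vanishes already. *)
  have [mn|nm] := ltnP m (2 * n).
    by apply: IHn => //; exact: iter_laplacian_homog_lt mn.
  (* The factor by which n Laplacians multiply H in |x|^(2n) H. Dividing by it makes |x|^(2n) H
     cancel the n-th iterated Laplacian of P; it is nonzero because [0 < d]. *)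
  pose c : nat := (\prod_(i < n) laplacian_coef d (m - 2 * n) i)%N.
  have c0 : (c%:R : K) != 0.
    rewrite pnatr_eq0 -lt0n prodn_gt0// => i.
    by case: (i : nat) => [|i'] /=; lia.
  pose H := c%:R^-1 *: iter n laplacian P.
  have hH' : solid_harmonic (m - 2 * n) H.
    by split; [rewrite rpredZ//; case: hH | rewrite laplacianZ hH.2 scaler0].
  rewrite -(subrK (norm_sqr ^+ n * H) P); apply: SD; last exact: SH hH'.
  have mE : m = (2 * n + (m - 2 * n))%N by lia.
  apply: IHn.
    rewrite rpredB// mE; apply: mpoly.dhomogM; last by case: hH'.
    by apply: mpoly.dhomogMn; exact: norm_sqr_homog.
  rewrite -scaleN1r iter_laplacianD iter_laplacianZ.
  rewrite (iter_laplacian_norm_sqrX_diag n hH') -/c /H -scaler_nat.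
  by rewrite scaleN1r scalerA divff// scale1r subrr.
(* The argument above needs homogeneity, so a general polynomial is split into its monomials. *)
elim/mpoly.mpolyind => // c m p _ _ Sp; apply: SD => //.
have [n lapn] := laplacian_nilpotent (c *: mpoly.mpolyX K m).
by apply: (homS n (mpoly.mdeg m)) => //; rewrite rpredZ// mpoly.dhomogX.
Qed.

(** * The Borel sets of Euclidean space *)

Section CountableBase.

Definition countable_base (T : topologicalType) (B : nat -> set T) :=
  (forall n, open (B n)) /\
  forall U x, open U -> U x -> exists2 n, B n x & B n `<=` U.

Lemma countable_base_open (T : topologicalType) (B : nat -> set T) (U : set T) :
  countable_base B -> open U ->
  U = \bigcup_(n in [set n | B n `<=` U]) B n.
Proof.
move=> [_ Bb] oU; apply/seteqP; split=> [x Ux|x [n BU /BU]//].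
by have [n Bx BU] := Bb _ _ oU Ux; exists n.
Qed.

(** Balls of the supremum norm with rational centres and radii 1/(m+1). Their shape as cubes is
    recorded because it turns conditions on vectors into conditions on coordinates. *)
Lemma countable_base_rV (R : realType) (d : nat) :
  exists B : nat -> set 'rV[R]_d, countable_base B /\
    forall n, B n = set0 \/ exists (q : 'rV[R]_d) (e : R),
      0 < e /\ B n = [set x | forall i, `|q ord0 i - x ord0 i| < e].
Proof.
pose B n : set 'rV[R]_d := if unpickle n is Some qm then
  ball (map_mx ratr (qm : 'rV[rat]_d * nat).1 : 'rV[R]_d) (qm.2.+1%:R^-1 : R)
  else set0.
exists B; split; [split|].
- by move=> n; rewrite /B; case: unpickle => [[q m]|]; [exact: ball_open|exact: open0].
- move=> U x oU Ux; have /nbhs_ballP[e /= e0 eU] : nbhs x U by exact: open_nbhs_nbhs.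
  have [m] : exists m : nat, m.+1%:R^-1 < e / 2.
    near \oo => m; exists m; near: m.
    exact: near_infty_natSinv_lt (PosNum (divr_gt0 e0 (ltr0n R 2))).
  have : 0 < m.+1%:R^-1 :> R by rewrite invr_gt0.
  move emE : (m.+1%:R^-1) => em em0 me.
  have [q qx] : exists q : 'rV[rat]_d, forall i,
      `|x ord0 i - ratr (q ord0 i)| < em.
    have /choice[q hq] : forall i : 'I_d, exists q : rat,
        `|x ord0 i - ratr q| < em.
      move=> i; have : x ord0 i - em < x ord0 i + em by lra.
      move=> /rat_in_itvoo[q]; rewrite in_itv/= => /andP[q1 q2].
      by exists q; rewrite ltr_norml; lra.
    by exists (\row_i q i) => i; rewrite mxE.
  exists (pickle (q, m)); rewrite /B pickleK/= emE.
    by split=> // i j; rewrite ord1 mxE /ball/= distrC.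
  move=> y [_ hy]; apply: eU; split=> // i j; have := hy i j.
  rewrite ord1 !mxE /ball/= => qy; have := qx j.
  have := ler_distD (ratr (q ord0 j)) (x ord0 j) (y ord0 j); lra.
- move=> n; rewrite /B; case: unpickle => [[q m]|]; [right|by left].
  exists (map_mx ratr q), (m.+1%:R^-1); split; first by rewrite invr_gt0.
  apply/seteqP; split=> x /=; first by move=> [_ h] i; exact: (h ord0 i).
  by move=> h; split=> [|i j]; rewrite ?invr_gt0// ord1; exact: h.
Unshelve. all: by end_near. Qed.

Lemma countable_base_R (R : realType) : exists B : nat -> set R, countable_base B.
Proof.
pose B n : set R := if unpickle n is Some pq then
  `](ratr (pq : rat * rat).1), (ratr pq.2)[%classic else set0.
exists B; split.
  by move=> n; rewrite /B; case: unpickle => [[q m]|]; [exact: interval_open|exact: open0].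
move=> U x oU Ux; have /nbhs_ballP[e /= e0 eU] : nbhs x U by exact: open_nbhs_nbhs.
have [p] : exists p, ratr p \in `](x - e), x[ by apply: rat_in_itvoo; lra.
have [q] : exists q, ratr q \in `]x, (x + e)[ by apply: rat_in_itvoo; lra.
rewrite !in_itv/= => /andP[q1 q2] /andP[p1 p2].
exists (pickle (p, q)); rewrite /B pickleK/= ?in_itv/= ?p2 ?q1//.
by move=> y /=; rewrite in_itv/= => yy; apply: eU; rewrite /ball/= ltr_norml; lra.
Qed.

(** The complement of the support is covered by open sets all of whose Borel subsets are null;
    countably many basic ones suffice, and they are made disjoint. Of sigma-additivity only the
    statement for null sets is assumed, so charges and measures are treated at once. *)
Lemma measure_support_null (T : ptopologicalType) (R : realType)
    (B : nat -> set T) (nu : set T -> \bar R) :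
  countable_base B ->
  (forall F : nat -> set T, (forall n, <<s @open T >> (F n)) ->
    trivIset setT F -> (forall n, nu (F n) = 0%E) -> nu (\bigcup_n F n) = 0%E) ->
  nu set0 = 0%E ->
  forall A, <<s @open T >> A -> A `<=` ~` measure_support nu -> nu A = 0%E.
Proof.
move=> bB hnu nu0 A mA AS.
pose null U := forall C, <<s @open T >> C -> C `<=` U -> nu C = 0%E.
pose F n := A `&` (if `[< null (B n) >] then B n else set0).
pose msr := @measurable _ (g_sigma_algebraType (@open T)).
have mF n : msr (F n).
  rewrite /F; case: asboolP => [|_]; last by rewrite setI0; exact: measurable0.
  move=> _; apply: (measurableI (A : set (g_sigma_algebraType (@open T)))) => //.
  by apply: sub_sigma_algebra; case: bB.
have AE : A = \bigcup_n seqDU F n.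
  rewrite -seqDU_bigcup_eq; apply/seteqP; split=> [x Ax|x [n _ []]//].
  have := AS _ Ax; rewrite /setC/= => /existsNP[U] /not_implyP[oU] /not_implyP[Ux].
  move=> /forallNP hU; have [n Bx BU] := bB.2 _ _ oU Ux.
  exists n => //; split=> //; case: asboolP => // -[] C mC CB.
  apply/eqP/negP => /negP/eqP nC; apply: (hU C); split => //.
  exact: subset_trans BU.
rewrite AE; apply: hnu.
- exact: seqDU_measurable mF.
- exact: trivIset_seqDU.
- move=> n; have mFn : msr (seqDU F n) by exact: seqDU_measurable mF n.
  have : seqDU F n `<=` F n by exact: subDsetl.
  rewrite {2}/F; case: asboolP => [nB sF|_].
    by apply: nB => // x /sF[].
  by rewrite setI0 subset0 => ->.
Qed.

End CountableBase.

Section EuclideanNorm.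
Context {R : realType} {d : nat}.
Implicit Types x y : 'rV[R]_d.

Lemma sumsq_ge0 x : 0 <= \sum_(i < d) x ord0 i ^+ 2.
Proof. by apply: sumr_ge0 => i _; exact: sqr_ge0. Qed.

Lemma enorm_ge0 x : 0 <= enorm x.
Proof. exact: sqrtr_ge0. Qed.

Lemma sqr_enorm x : enorm x ^+ 2 = \sum_(i < d) x ord0 i ^+ 2.
Proof. by rewrite sqr_sqrtr// sumsq_ge0. Qed.

Lemma enormZ (c : R) x : enorm (c *: x) = `|c| * enorm x.
Proof.
rewrite /enorm; under eq_bigr do rewrite mxE exprMn.
by rewrite -mulr_sumr sqrtrM ?sqr_ge0// sqrtr_sqr.
Qed.

Lemma normr_coord_le_enorm x i : `|x ord0 i| <= enorm x.
Proof.
rewrite -(sqrtr_sqr (x ord0 i)) ler_sqrt ?sumsq_ge0//.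
by rewrite (bigD1 i)//= lerDl sumr_ge0// => j _; exact: sqr_ge0.
Qed.

Lemma enorm_eq0 x : (enorm x == 0) = (x == 0).
Proof.
apply/eqP/eqP => [x0|->]; last first.
  by rewrite /enorm big1 ?sqrtr0// => i _; rewrite mxE expr0n.
apply/rowP => i; rewrite mxE; apply/eqP; rewrite -normr_eq0 eq_le normr_ge0 andbT.
by rewrite -x0 normr_coord_le_enorm.
Qed.

Lemma enorm_direction x : x != 0 -> enorm (direction x) = 1.
Proof.
by rewrite -enorm_eq0 => x0; rewrite enormZ ger0_norm ?invr_ge0 ?enorm_ge0// mulVf.
Qed.

Lemma enormM_direction x : enorm x *: direction x = x.
Proof.
have [->|x0] := eqVneq x 0; first by rewrite /direction !scaler0.
by rewrite /direction scalerA divff ?enorm_eq0// scale1r.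
Qed.

Lemma continuous_mulr (T : topologicalType) (f g : T -> R) :
  continuous f -> continuous g -> continuous (fun t => f t * g t).
Proof. by move=> cf cg t; apply: cvgM; [exact: cf|exact: cg]. Qed.

Lemma continuous_addr (T : topologicalType) (f g : T -> R) :
  continuous f -> continuous g -> continuous (fun t => f t + g t).
Proof. by move=> cf cg t; apply: cvgD; [exact: cf|exact: cg]. Qed.

Lemma continuous_normr (T : topologicalType) (f : T -> R) :
  continuous f -> continuous (fun t => `|f t|).
Proof. by move=> cf t; apply: cvg_norm; exact: cf. Qed.

Lemma continuous_sumr (T : topologicalType) n (F : 'I_n -> T -> R) :
  (forall i, continuous (F i)) -> continuous (fun t => \sum_(i < n) F i t).
Proof.
move=> cF; elim: n F cF => [|n IHn] F cF t.
  by under eq_fun do rewrite big_ord0; exact: cvg_cst.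
under eq_fun do rewrite big_ord_recr.
by apply: cvgD; [exact: (IHn (fun i => F (widen_ord (leqnSn n) i)))|exact: cF].
Qed.

Lemma continuous_sqr_enorm : continuous (fun x : 'rV[R]_d => enorm x ^+ 2).
Proof.
under eq_fun do rewrite sqr_enorm.
apply: continuous_sumr => i; under eq_fun do rewrite expr2.
by apply: continuous_mulr; exact: coord_continuous.
Qed.

Lemma continuous_enorm : continuous (enorm : 'rV[R]_d -> R).
Proof.
have -> : (enorm : 'rV[R]_d -> R) = Num.sqrt \o (fun x => enorm x ^+ 2).
  by apply/funext => x /=; rewrite sqrtr_sqr ger0_norm// enorm_ge0.
move=> x; apply: continuous_comp; first exact: continuous_sqr_enorm.
exact: sqrt_continuous.
Qed.

Lemma closed_eball (r : R) : closed (eball r : set 'rV[R]_d).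
Proof.
rewrite (_ : eball r = enorm @^-1` [set t | t <= r]); last by [].
by apply: closed_comp => [x _|]; [exact: continuous_enorm|exact: closed_le].
Qed.

Lemma compact_eball (r : R) : compact (eball r : set 'rV[R]_d).
Proof.
apply: bounded_closed_compact; last exact: closed_eball.
exists `|r|; split; first exact: num_real.
move=> M rM x xr /=; rewrite [leLHS]/Num.Def.normr/= mx_normrE.
apply: bigmax_le => [|[i j] _ /=]; first by rewrite ltW// (le_lt_trans _ rM).
rewrite ord1 (le_trans (normr_coord_le_enorm x j))//.
by rewrite (le_trans xr)// (le_trans (ler_norm _))// ltW.
Qed.

End EuclideanNorm.

Section BorelRV.
Context {R : realType} {d : nat}.

Lemma borel_open (U : set 'rV[R]_d) : open U -> measurable (U : set (borel_rV R d)).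
Proof. by move=> oU; exact: sub_sigma_algebra. Qed.

Lemma borel_closed (U : set 'rV[R]_d) :
  closed U -> measurable (U : set (borel_rV R d)).
Proof. by move=> cU; have := measurableC (borel_open (closed_openC cU)); rewrite setCK. Qed.

Lemma borel_eball (r : R) : measurable (eball r : set (borel_rV R d)).
Proof. by apply: borel_closed; exact: closed_eball. Qed.

Lemma within_continuous_measurable (D : set 'rV[R]_d) (f : 'rV[R]_d -> R) :
  measurable (D : set (borel_rV R d)) -> {within D, continuous f} ->
  measurable_fun (D : set (borel_rV R d)) f.
Proof.
move=> mD /continuousP cf; apply: (measurability _ (RGenOpens.measurableE R)).
move=> _ [_ [a [b ->] <-]].
have /open_subspaceP[V oV VD] := cf _ (@interval_open _ (BRight a) (BLeft b) erefl erefl).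
rewrite setIC -VD; apply: measurableI => //; exact: borel_open.
Qed.

Lemma continuous_measurable_rV (f : 'rV[R]_d -> R) :
  continuous f -> measurable_fun (setT : set (borel_rV R d)) f.
Proof.
move=> cf; apply: within_continuous_measurable => //.
by apply: continuous_subspaceT.
Qed.

(** An open set is a countable union of cubes, and the preimage of a cube is a finite intersection
    of conditions on single coordinates. *)
Lemma measurable_rVP (disp : measure_display) (T : measurableType disp)
    (g : T -> borel_rV R d) :
  (forall i : 'I_d, measurable_fun setT (fun t => (g t : 'rV[R]_d) ord0 i)) ->
  measurable_fun setT g.
Proof.
move=> mg; have [B [bB hB]] := countable_base_rV R d.
apply: (@measurability _ _ T (borel_rV R d) setT g (@open 'rV[R]_d)) => //.
move=> _ [U oU <-]; rewrite setTI.
rewrite (countable_base_open bB oU) preimage_bigcup.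
apply: bigcup_measurable => n _; have [->|[q [e [e0 ->]]]] := hB n.
  by rewrite preimage_set0.
rewrite (_ : _ @^-1` _ =
    \bigcap_(i in [set: 'I_d]) [set t | `|q ord0 i - (g t : 'rV[R]_d) ord0 i| < e]).
  apply: fin_bigcap_measurable => // i _.
  have -> : [set t | `|q ord0 i - (g t : 'rV[R]_d) ord0 i| < e] =
      setT `&` (fun t => `|q ord0 i - (g t : 'rV[R]_d) ord0 i|) @^-1` [set` `]-oo, e[].
    by rewrite setTI; apply/seteqP; split=> t /=; rewrite in_itv.
  have mf : measurable_fun setT
      (fun t => `|q ord0 i - (g t : 'rV[R]_d) ord0 i| : measurableTypeR R).
    by apply: measurableT_comp => //; exact: measurable_funB.
  exact: mf.
by apply/seteqP; split=> t /= h i; [move=> _|]; apply: h.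
Qed.

End BorelRV.

(** * Integrals against a signed measure *)

Section SignedIntegralTheory.
Context {disp : measure_display} {T : measurableType disp} {R : realType}.
Variable D : set T.
Hypothesis mD : measurable D.
Implicit Types (f g : T -> R) (nu : {charge set T -> \bar R}).

(** Jordan parts are finite measures, so such functions are integrable against both; unlike
    integrability, this property is stable under products. *)
Definition bounded_measurable f :=
  measurable_fun D f /\ exists M : R, forall x, D x -> `|f x| <= M.

Lemma bounded_measurable_cst (c : R) : bounded_measurable (fun=> c).
Proof. by split; [exact: measurable_cst | exists `|c|]. Qed.

Lemma bounded_measurableD f g : bounded_measurable f -> bounded_measurable g ->
  bounded_measurable (fun x => f x + g x).
Proof.
move=> [mf [M hM]] [mg [N hN]]; split; first exact: measurable_funD.
by exists (M + N) => x Dx; rewrite (le_trans (ler_normD _ _))// lerD ?hM ?hN.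
Qed.

Lemma bounded_measurableM f g : bounded_measurable f -> bounded_measurable g ->
  bounded_measurable (fun x => f x * g x).
Proof.
move=> [mf [M hM]] [mg [N hN]]; split; first exact: measurable_funM.
by exists (M * N) => x Dx; rewrite normrM ler_pM ?hM ?hN.
Qed.

Lemma bounded_measurableZ (c : R) f : bounded_measurable f ->
  bounded_measurable (fun x => c * f x).
Proof. by apply: bounded_measurableM; exact: bounded_measurable_cst. Qed.

Lemma bounded_measurableB f g : bounded_measurable f -> bounded_measurable g ->
  bounded_measurable (fun x => f x - g x).
Proof.
move=> bf /(bounded_measurableZ (-1)) bg.
by under eq_fun do rewrite -mulN1r; exact: bounded_measurableD.
Qed.

Lemma bounded_measurable_sum n (F : 'I_n -> T -> R) :
  (forall i, bounded_measurable (F i)) ->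
  bounded_measurable (fun x => \sum_(i < n) F i x).
Proof.
elim: n F => [|n IHn] F bF.
  under eq_fun do rewrite big_ord0; exact: bounded_measurable_cst.
under eq_fun do rewrite big_ord_recr; apply: bounded_measurableD => //.
exact: (IHn (fun i => F (widen_ord (leqnSn n) i))).
Qed.

Lemma bounded_measurable_integrable (m : {measure set T -> \bar R}) f :
  (m D < +oo)%E -> bounded_measurable f -> m.-integrable D (EFin \o f).
Proof.
move=> mDoo [mf [M hM]]; apply: measurable_bounded_integrable => //.
exists M; split; first exact: num_real.
by move=> N MN x Dx /=; rewrite (le_trans (hM _ Dx))// ltW.
Qed.

Lemma Rintegral_bounded_sum (m : {measure set T -> \bar R}) n (F : 'I_n -> T -> R) :
  (m D < +oo)%E -> (forall i, bounded_measurable (F i)) ->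
  Rintegral m D (fun x => \sum_(i < n) F i x) = \sum_(i < n) Rintegral m D (F i).
Proof.
move=> mDoo; elim: n F => [|n IHn] F bF.
  under eq_Rintegral do rewrite big_ord0.
  by rewrite Rintegral_cst// mul0r big_ord0.
under eq_Rintegral do rewrite big_ord_recr.
rewrite big_ord_recr/= RintegralD//.
- by rewrite (IHn (fun i => F (widen_ord (leqnSn n) i))).
- apply: bounded_measurable_integrable => //.
  exact: (@bounded_measurable_sum _ (fun i => F (widen_ord (leqnSn n) i))).
- exact: bounded_measurable_integrable.
Qed.

Lemma Rintegral_bounded_cvg (m : {measure set T -> \bar R}) (F : nat -> T -> R) f
    (M : R) : (m D < +oo)%E ->
  (forall n, measurable_fun D (F n)) -> measurable_fun D f ->
  (forall n x, D x -> `|F n x| <= M) ->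
  (forall x, D x -> F n x @[n --> \oo] --> f x) ->
  Rintegral m D (F n) @[n --> \oo] --> Rintegral m D f.
Proof.
move=> mDoo mF mf hM Ff.
have mM : m.-integrable D (EFin \o (fun=> M)).
  by apply: bounded_measurable_integrable => //; exact: bounded_measurable_cst.
have FfE x : D x -> (F n x)%:E @[n --> \oo] --> (f x)%:E.
  by move=> Dx; apply: cvg_EFin; [exact: nearW | exact: Ff].
have [intf _] := @dominated_convergence _ T R m D mD
  (fun n => EFin \o F n) (EFin \o f) (EFin \o (fun=> M))
  (fun n => (measurable_EFinP _ _).2 (mF n)) ((measurable_EFinP _ _).2 mf)
  (aeW _ FfE) mM (aeW _ (fun x n Dx => hM n x Dx)).
by rewrite -{1}(fineK (integrable_fin_num mD intf)) => /fine_cvg.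
Qed.

Let jp nu : {finite_measure set T -> \bar R} := jordan_pos (hahn_pairP nu).
Let jn nu : {finite_measure set T -> \bar R} := jordan_neg (hahn_pairP nu).

Let jp_int nu f : bounded_measurable f -> (jp nu).-integrable D (EFin \o f).
Proof. by apply: bounded_measurable_integrable; rewrite ltey_eq fin_num_measure. Qed.

Let jn_int nu f : bounded_measurable f -> (jn nu).-integrable D (EFin \o f).
Proof. by apply: bounded_measurable_integrable; rewrite ltey_eq fin_num_measure. Qed.

(** The total variation of [nu] on [D]. *)
Definition charge_mass nu : R := fine (jp nu D) + fine (jn nu D).

Lemma charge_mass_ge0 nu : 0 <= charge_mass nu.
Proof. by rewrite addr_ge0// fine_ge0// measure_ge0. Qed.

Lemma eq_signed_integral nu f g : (forall x, D x -> f x = g x) ->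
  signed_integral nu D f = signed_integral nu D g.
Proof.
by move=> fg; congr (_ - _); apply: eq_Rintegral => x; rewrite inE; exact: fg.
Qed.

Lemma signed_integralD nu f g : bounded_measurable f -> bounded_measurable g ->
  signed_integral nu D (fun x => f x + g x) =
  signed_integral nu D f + signed_integral nu D g.
Proof.
move=> bf bg; rewrite /signed_integral.
rewrite (RintegralD mD (jp_int nu bf) (jp_int nu bg)).
rewrite (RintegralD mD (jn_int nu bf) (jn_int nu bg)).
by rewrite opprD addrACA.
Qed.

Lemma signed_integralZ nu (c : R) f : bounded_measurable f ->
  signed_integral nu D (fun x => c * f x) = c * signed_integral nu D f.
Proof.
move=> bf; rewrite /signed_integral.
rewrite (RintegralZl _ mD (jp_int nu bf)) (RintegralZl _ mD (jn_int nu bf)).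
by rewrite mulrBr.
Qed.

Lemma signed_integralB nu f g : bounded_measurable f -> bounded_measurable g ->
  signed_integral nu D (fun x => f x - g x) =
  signed_integral nu D f - signed_integral nu D g.
Proof.
move=> bf bg; under eq_fun do rewrite -mulN1r.
by rewrite signed_integralD ?signed_integralZ ?mulN1r//; exact: bounded_measurableZ.
Qed.

Lemma signed_integral_sum nu n (F : 'I_n -> T -> R) :
  (forall i, bounded_measurable (F i)) ->
  signed_integral nu D (fun x => \sum_(i < n) F i x) =
  \sum_(i < n) signed_integral nu D (F i).
Proof.
elim: n F => [|n IHn] F bF.
  under eq_fun do rewrite big_ord0.
  rewrite big_ord0 -(mul0r 0) signed_integralZ ?mul0r//.
  exact: bounded_measurable_cst.
under eq_fun do rewrite big_ord_recr; rewrite big_ord_recr/= signed_integralD//.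
  by rewrite (IHn (fun i => F (widen_ord (leqnSn n) i))).
exact: (@bounded_measurable_sum _ (fun i => F (widen_ord (leqnSn n) i))).
Qed.

Lemma normr_signed_integral_le nu f (M : R) : bounded_measurable f ->
  (forall x, D x -> `|f x| <= M) ->
  `|signed_integral nu D f| <= M * charge_mass nu.
Proof.
move=> bf hM.
have bnf : bounded_measurable (fun x => `|f x|).
  case: bf => mf [N hN]; split; first exact: measurableT_comp.
  by exists N => x Dx; rewrite normr_id hN.
have bnd (m : {finite_measure set T -> \bar R}) :
    m.-integrable D (EFin \o f) -> m.-integrable D (EFin \o (fun x => `|f x|)) ->
    `|Rintegral m D f| <= M * fine (m D).
  move=> mf mnf; rewrite (le_trans (le_normr_Rintegral mD mf))//.
  rewrite -Rintegral_cst//; apply: le_Rintegral => //.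
  apply: bounded_measurable_integrable; last exact: bounded_measurable_cst.
  by rewrite ltey_eq fin_num_measure.
rewrite (le_trans (ler_normB _ _))// mulrDr lerD//.
  exact: (bnd _ (jp_int nu bf) (jp_int nu bnf)).
exact: (bnd _ (jn_int nu bf) (jn_int nu bnf)).
Qed.

Lemma signed_integral_cvg nu (F : nat -> T -> R) f (M : R) :
  (forall n, measurable_fun D (F n)) -> measurable_fun D f ->
  (forall n x, D x -> `|F n x| <= M) ->
  (forall x, D x -> F n x @[n --> \oo] --> f x) ->
  signed_integral nu D (F n) @[n --> \oo] --> signed_integral nu D f.
Proof.
move=> mF mf hM Ff.
have cvgm (m : {finite_measure set T -> \bar R}) :
    Rintegral m D (F n) @[n --> \oo] --> Rintegral m D f.
  apply: (@Rintegral_bounded_cvg _ _ _ M) => //.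
  by rewrite ltey_eq fin_num_measure.
by apply: cvgB; exact: cvgm.
Qed.

(** The Jordan parts of the complement of [D] are, up to sign, the values of [nu] on its
    intersections with the two Hahn sets. It is therefore necessary to know that all measurable
    subsets of the complement are null. *)
Lemma signed_integral_setT nu f :
  (forall A, measurable A -> A `<=` ~` D -> nu A = 0%E) ->
  measurable_fun setT f ->
  signed_integral nu setT f = signed_integral nu D f.
Proof.
move=> nuD mf.
have jp0 : jp nu (~` D) = 0%E.
  have mC := measurableC mD.
  rewrite -[LHS]/(jordan_pos (hahn_pairP nu) (~` D)).
  rewrite jordan_posE cjordan_posE /crestr0 mem_set// /crestr nuD//.
  by case: (hahn_pairP nu) => -[mP _] _ _ _; exact: measurableI.
have jn0 : jn nu (~` D) = 0%E.
  have mC := measurableC mD.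
  rewrite -[LHS]/(jordan_neg (hahn_pairP nu) (~` D)).
  rewrite jordan_negE cjordan_negE /crestr0 mem_set// /crestr nuD ?oppe0//.
  by case: (hahn_pairP nu) => _ [mN _] _ _; exact: measurableI.
have eqm (m : {finite_measure set T -> \bar R}) : m (~` D) = 0%E ->
    Rintegral m setT f = Rintegral m D f.
  move=> m0; rewrite (Rintegral_mkcond _ D) /Rintegral; congr fine.
  apply: ae_eq_integral => //; [exact/measurable_EFinP| |].
    by apply/measurable_EFinP/measurable_restrict => //; rewrite setTI;
      exact: measurable_funS mf.
  exists (~` D); split => //; first exact: measurableC.
  move=> x /=; apply: contra_not => Dx _; rewrite patchE mem_set//.
by congr (_ - _); exact: eqm.
Qed.

End SignedIntegralTheory.

(** * Lebesgue measure on row vectors *)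

Section LebesgueRV.
Context {R : realType}.

Lemma continuous_rVP (T : topologicalType) n (g : T -> 'rV[R]_n) :
  (forall i, continuous (fun t => g t ord0 i)) -> continuous g.
Proof.
move=> cg t; apply/cvg_ballP => e e0.
have : \forall x \near t, forall i, ball (g t ord0 i) e (g x ord0 i).
  by apply: filter_forall => i; apply: (cvg_ball (cg i t)).
by apply: filterS => x gx; split=> // i j; rewrite ord1.
Qed.

Lemma sigma_finite_measureP (disp : measure_display) (T : measurableType disp)
    (m : {measure set T -> \bar R}) : sigma_finite setT m ->
  exists m' : {sigma_finite_measure set T -> \bar R},
    (m' : set T -> \bar R) = m.
Proof.
move=> sm; have H1 := @isSFinite.Build _ _ _ m (sfinite_measure_sigma_finite sm).
have H2 := @isSigmaFinite.Build _ _ _ m sm.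
by exists (HB.pack_for (SigmaFiniteMeasure.type T R) (Measure.sort m) H1 H2).
Qed.

(** The gluing map in the recursion for [lebesgue_rV], which is thus an iterated pushforward of
    product measures. *)
Definition cons_rV n (p : R * 'rV[R]_n) : 'rV[R]_n.+1 := row_mx (p.1)%:M p.2.

Lemma cons_rV0 n (p : R * 'rV[R]_n) : cons_rV p ord0 ord0 = p.1.
Proof.
transitivity (row_mx (p.1)%:M p.2 ord0 (lshift n (ord0 : 'I_1))).
  by congr (cons_rV p _ _); exact: val_inj.
by rewrite row_mxEl mxE eqxx mulr1n.
Qed.

Lemma cons_rVS n (p : R * 'rV[R]_n) j : cons_rV p ord0 (lift ord0 j) = p.2 ord0 j.
Proof.
transitivity (row_mx (p.1)%:M p.2 ord0 (rshift 1 j)); last by rewrite row_mxEr.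
by congr (cons_rV p _ _); exact: val_inj.
Qed.

Lemma sumsq_cons_rV n (p : R * 'rV[R]_n) :
  \sum_i cons_rV p ord0 i ^+ 2 = p.1 ^+ 2 + \sum_i p.2 ord0 i ^+ 2.
Proof.
rewrite big_ord_recl cons_rV0; congr (_ + _).
by apply: eq_bigr => i _; rewrite cons_rVS.
Qed.

Lemma continuous_cons_rVr n (s : R) : continuous (fun y : 'rV[R]_n => cons_rV (s, y)).
Proof.
apply: continuous_rVP => i; case: (unliftP ord0 i) => [j ->|->].
  under eq_fun do rewrite cons_rVS; exact: coord_continuous.
by under eq_fun do rewrite cons_rV0; exact: cst_continuous.
Qed.

Lemma continuous_cons_rVl n (y : 'rV[R]_n) : continuous (fun s : R => cons_rV (s, y)).
Proof.
apply: continuous_rVP => i; case: (unliftP ord0 i) => [j ->|->].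
  by under eq_fun do rewrite cons_rVS; exact: cst_continuous.
by under eq_fun do rewrite cons_rV0; move=> s; exact: cvg_id.
Qed.

Lemma measurable_cons_rV n : measurable_fun setT
  (cons_rV (n := n) : measurableTypeR R * borel_rV R n -> borel_rV R n.+1).
Proof.
apply: measurable_rVP => i; case: (unliftP ord0 i) => [j ->|->].
  under eq_fun do rewrite cons_rVS.
  apply: (@measurableT_comp _ _ _ _ _ _ (fun y : borel_rV R n => (y : 'rV[R]_n) ord0 j)).
    by apply: continuous_measurable_rV; exact: coord_continuous.
  exact: measurable_snd.
under eq_fun do rewrite cons_rV0; exact: measurable_fst.
Qed.

Lemma lebesgue_rVS n (m : {sigma_finite_measure set (borel_rV R n) -> \bar R}) :
  @lebesgue_rV R n = m ->
  @lebesgue_rV R n.+1 =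
    pushforward (lebesgue_measure \x m)%E
      (cons_rV (n := n) : measurableTypeR R * borel_rV R n -> borel_rV R n.+1).
Proof. by move=> mE; apply/funext => A /=; rewrite mE. Qed.

(** Sigma-finiteness has to be carried through the recursion, since the product in the next
    dimension relies on it. It follows from the finiteness of balls: a ball lies in the product of
    an interval and a ball of one dimension less. *)
Lemma lebesgue_rV_measure n :
  exists2 m : {sigma_finite_measure set (borel_rV R n) -> \bar R},
    @lebesgue_rV R n = m & forall r : R, (m (eball r : set 'rV[R]_n) < +oo)%E.
Proof.
elim: n => [|n [m mE mfin]].
  have [m' m'E] : exists m' : {sigma_finite_measure set (borel_rV R 0) -> \bar R},
      (m' : set (borel_rV R 0) -> \bar R) = dirac (0 : borel_rV R 0).
    apply: sigma_finite_measureP; apply: fin_num_fun_sigma_finite.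
      by rewrite measure0.
    exact: fin_num_measure.
  exists m' => [|r]; first by rewrite m'E.
  by rewrite m'E diracE; case: (_ \in _); rewrite ltry.
have [P PE] : exists P : {measure set (borel_rV R n.+1) -> \bar R},
    (P : set (borel_rV R n.+1) -> \bar R) = pushforward (lebesgue_measure \x m)%E
    (cons_rV (n := n) : measurableTypeR R * borel_rV R n -> borel_rV R n.+1).
  pose phi : measurableTypeR R * borel_rV R n -> borel_rV R n.+1 := cons_rV (n := n).
  have mphi : measurable_fun setT phi := @measurable_cons_rV n.
  pose Q : {measure set (borel_rV R n.+1) -> \bar R} :=
    [the measure _ _ of pushforward (lebesgue_measure \x m)%E phi].
  by exists (Q mphi).
have Pfin (r : R) : (P (eball r : set 'rV[R]_n.+1) < +oo)%E.
  rewrite PE; pose C := (`[(- r), r]%classic : set (measurableTypeR R)) `*` (eball r : set (borel_rV R n)).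
  have mC : measurable C by apply: measurableX => //; exact: borel_eball.
  apply: (@le_lt_trans _ _ ((lebesgue_measure \x m)%E C)).
    rewrite /pushforward; apply: le_measure; rewrite ?inE//.
      rewrite -[X in measurable X]setTI; apply: measurable_cons_rV => //.
      exact: borel_eball.
    move=> [s y] /= h; have s0 : cons_rV (s, y) ord0 ord0 = s by rewrite cons_rV0.
    split; first by rewrite /= in_itv/= -ler_norml -s0 (le_trans (normr_coord_le_enorm _ _)).
    apply: le_trans h; rewrite /enorm ler_sqrt ?sumsq_ge0// sumsq_cons_rV.
    by rewrite lerDr sqr_ge0.
  rewrite product_measure1E//; last exact: borel_eball.
  apply: lte_mul_pinfty; [exact: measure_ge0| |exact: mfin].
  rewrite -[X in X \is a fin_num]/(lebesgue_measure ([set` `[(- r), r]] : set R)).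
  by rewrite lebesgue_measure_itv/=; case: ifP.
have [m' m'E] : exists m' : {sigma_finite_measure set (borel_rV R n.+1) -> \bar R},
    (m' : set (borel_rV R n.+1) -> \bar R) = P.
  apply: sigma_finite_measureP.
  exists (fun k => eball k%:R).
    apply/seteqP; split=> // x _; exists (Num.Def.archi_bound (enorm x)) => //.
    exact: (ltW (archi_boundP (enorm_ge0 x))).
  by move=> k; split; [exact: borel_eball|exact: Pfin].
exists m' => [|r]; last by rewrite m'E.
by rewrite m'E PE; exact: lebesgue_rVS.
Qed.

End LebesgueRV.

Lemma continuous_bounded_measurable (R : realType) d (D : set 'rV[R]_d)
    (f : 'rV[R]_d -> R) : compact D -> measurable (D : set (borel_rV R d)) ->
  {within D, continuous f} -> bounded_measurable (D : set (borel_rV R d)) f.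
Proof.
move=> cD mD cf; split; first exact: within_continuous_measurable.
have := continuous_compact cf cD => /compact_bounded[M [_ hM]].
by exists (M + 1) => x Dx; apply: (hM (M + 1)); [rewrite ltrDl | exists x].
Qed.

(** * Integrals of partial derivatives over Euclidean balls *)

Section BallIntegrationByParts.
Context {R : realType}.
Notation sfm n := {sigma_finite_measure set (borel_rV R n) -> \bar R}.

(** Balls are indexed by the squared radius: the slice at first coordinate s then has parameter c -
    s^2, and a negative parameter simply gives the empty set. *)
Definition sumsq_le n (c : R) : set 'rV[R]_n := [set x | \sum_i x ord0 i ^+ 2 <= c].
Arguments sumsq_le n c : clear implicits.

Lemma sumsq_le_eball n (c : R) : 0 <= c -> sumsq_le n c = eball (Num.sqrt c).
Proof.
by move=> c0; apply/seteqP; split=> x; rewrite /sumsq_le /eball /enorm/= ler_sqrt.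
Qed.

Lemma sumsq_le_set0 n (c : R) : c < 0 -> sumsq_le n c = set0.
Proof.
move=> c0; apply/seteqP; split=> // x /= h.
by have := le_lt_trans (le_trans (sumsq_ge0 x) h) c0; rewrite ltxx.
Qed.

Lemma measurable_sumsq_le n (c : R) : measurable (sumsq_le n c : set (borel_rV R n)).
Proof.
have [c0|c0] := leP 0 c; last by rewrite sumsq_le_set0.
by rewrite sumsq_le_eball//; exact: borel_eball.
Qed.

Lemma compact_sumsq_le n (c : R) : compact (sumsq_le n c).
Proof.
have [c0|c0] := leP 0 c; last by rewrite sumsq_le_set0//; exact: compact0.
by rewrite sumsq_le_eball//; exact: compact_eball.
Qed.

Lemma lebesgue_rV_sumsq_le_lty n (m : sfm n) (c : R) :
  @lebesgue_rV R n = m -> (m (sumsq_le n c : set 'rV[R]_n) < +oo)%E.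
Proof.
move=> mE; have [m' m'E fin] := @lebesgue_rV_measure R n.
rewrite -mE m'E; have [c0|c0] := leP 0 c; last by rewrite sumsq_le_set0// measure0.
by rewrite sumsq_le_eball.
Qed.

(** Fubini in both orders: the first coordinate is outermost when the remaining ones are handled by
    induction, and innermost when it is itself the variable of integration by parts. *)
Lemma integral_cons_rV n (m : sfm n) (m' : sfm n.+1) (S : set (borel_rV R n.+1))
    (f : 'rV[R]_n.+1 -> R) :
  @lebesgue_rV R n = m -> @lebesgue_rV R n.+1 = m' -> measurable S ->
  (m' S < +oo)%E -> bounded_measurable S f ->
  (\int[m']_(x in S) (f x)%:E =
     \int[lebesgue_measure]_s \int[m]_y ((f \_ S) (cons_rV (s, y)))%:E)%E /\
  (\int[m']_(x in S) (f x)%:E =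
     \int[m]_y \int[lebesgue_measure]_s ((f \_ S) (cons_rV (s, y)))%:E)%E.
Proof.
move=> mE m'E mS Sfin bf.
pose phi : measurableTypeR R * borel_rV R n -> borel_rV R n.+1 := cons_rV (n := n).
have mphi : measurable_fun setT phi := @measurable_cons_rV R n.
have m'P : (m' : set _ -> \bar R) = pushforward (lebesgue_measure \x m)%E phi.
  by rewrite -m'E; exact: lebesgue_rVS.
pose g : borel_rV R n.+1 -> R := f \_ S.
have mg : measurable_fun setT (EFin \o g).
  by apply/measurable_EFinP/measurable_restrict => //; rewrite setTI; case: bf.
have mphiS : measurable (phi @^-1` S).
  by rewrite -[X in measurable X]setTI; exact: mphi.
have intg : (lebesgue_measure \x m)%E.-integrable (phi @^-1` setT) ((EFin \o g) \o phi).
  rewrite preimage_setT.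
  have -> : (EFin \o g) \o phi = (EFin \o (f \o phi)) \_ (phi @^-1` S).
    by apply/funext => p /=; rewrite /g restrict_EFin/= !patchE.
  apply/(integrable_mkcond _ mphiS).1.
  apply: (@bounded_measurable_integrable _ _ _ _ mphiS) => //.
    by move: Sfin; rewrite m'P.
  case: bf => mf [M hM]; split; last by exists M => p; exact: hM.
  apply: (measurable_comp mS) => //; first exact: image_preimage_subset.
  exact: measurable_funTS.
have int_g : (\int[m']_(x in S) (f x)%:E = \int[lebesgue_measure \x m]_p (g (phi p))%:E)%E.
  rewrite integral_mkcond.
  have -> : (fun x => (f x)%:E) \_ S = EFin \o g by rewrite /g restrict_EFin.
  transitivity (\int[pushforward (lebesgue_measure \x m)%E phi]_x (EFin \o g) x)%E.
    by apply: eq_measure_integral => A _ _; exact: (congr1 (fun h => h A) m'P).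
  by rewrite integral_pushforward.
rewrite preimage_setT in intg.
split; rewrite int_g.
  by have := integral12_prod_meas1 intg => /esym.
by have := integral21_prod_meas1 intg => /esym.
Qed.

Definition update_rV n (x : 'rV[R]_n) (i : 'I_n) (t : R) : 'rV[R]_n :=
  \row_j (if j == i then t else x ord0 j).

Lemma update_cons_rV0 n s t (y : 'rV[R]_n) :
  update_rV (cons_rV (s, y)) ord0 t = cons_rV (t, y).
Proof.
apply/rowP => k; rewrite mxE; case: (unliftP ord0 k) => [j ->|->].
  by rewrite !cons_rVS.
by rewrite eqxx cons_rV0.
Qed.

Lemma update_cons_rVS n s t (y : 'rV[R]_n) i :
  update_rV (cons_rV (s, y)) (lift ord0 i) t = cons_rV (s, update_rV y i t).
Proof.
apply/rowP => k; rewrite mxE; case: (unliftP ord0 k) => [j ->|->].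
  by rewrite !cons_rVS mxE (inj_eq lift_inj).
by rewrite !cons_rV0.
Qed.

(** On each chord parallel to the i-th axis the fundamental theorem of calculus leaves the values of
    F at the end points, which lie on the sphere. The induction peels off first coordinates until
    the i-th one comes first, and therefore needs every [c]. *)
Lemma integral_ball_partial0 n (m : sfm n) (i : 'I_n) (F f : 'rV[R]_n -> R) (c : R) :
  @lebesgue_rV R n = m -> continuous f ->
  (forall x (t : R), is_derive t (1 : R) (fun u : R => F (update_rV x i u)) (f (update_rV x i t))) ->
  (forall x : 'rV[R]_n, \sum_j x ord0 j ^+ 2 = c -> F x = 0) ->
  (\int[m]_(x in sumsq_le n c) (f x)%:E = 0)%E.
Proof.
elim: n m i F f c => [|n IHn] m' i F f c m'E cf dF F0.
  by have := ltn_ord i.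
have [m mE _] := @lebesgue_rV_measure R n.
have [int1 int2] := integral_cons_rV mE m'E (@measurable_sumsq_le n.+1 c)
  (lebesgue_rV_sumsq_le_lty c m'E) (continuous_bounded_measurable
    (@compact_sumsq_le n.+1 c) (@measurable_sumsq_le n.+1 c)
    (continuous_subspaceT cf)).
case: (unliftP ord0 i) dF => [j|] -> dF.
  rewrite int1; apply: integral0_eq => s _.
  have <- : (\int[m]_(y in sumsq_le n (c - s ^+ 2)) (f (cons_rV (s, y)))%:E = 0)%E.
    apply: (IHn m j (fun y => F (cons_rV (s, y)))) => //.
    - by move=> y; apply: continuous_comp; [exact: continuous_cons_rVr|exact: cf].
    - move=> y t; have := dF (cons_rV (s, y)) t; rewrite update_cons_rVS.
      by under eq_fun do rewrite update_cons_rVS.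
    - move=> y yc; apply: F0; rewrite sumsq_cons_rV /= yc; ring.
  rewrite [RHS]integral_mkcond; apply: eq_integral => y _.
  rewrite restrict_EFin/= !patchE; congr (EFin _); congr (if _ then _ else _).
  by apply/idP/idP; rewrite !inE /sumsq_le/= sumsq_cons_rV -lerBrDl.
rewrite int2; apply: integral0_eq => y _.
have [c0|c0] := leP 0 (c - \sum_i y ord0 i ^+ 2); last first.
  apply: integral0_eq => s _; rewrite patchE memNset// /sumsq_le/= sumsq_cons_rV/=.
  by move=> h; move: c0; rewrite ltNge => /negP; apply; move: (sqr_ge0 s); lra.
(* The chord over y is [-b, b]; it may degenerate to a point. *)
set b := Num.sqrt (c - \sum_i y ord0 i ^+ 2).
have b2 : b ^+ 2 = c - \sum_i y ord0 i ^+ 2 by rewrite sqr_sqrtr.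
have -> : (\int[lebesgue_measure]_s ((f \_ (sumsq_le n.+1 c)) (cons_rV (s, y)))%:E =
    \int[lebesgue_measure]_(s in `[(- b)%R, b]) (f (cons_rV (s, y)))%:E)%E.
  rewrite [RHS]integral_mkcond; apply: eq_integral => s _.
  rewrite restrict_EFin/= !patchE; congr (EFin _); congr (if _ then _ else _).
  apply/idP/idP; rewrite !inE /sumsq_le/= sumsq_cons_rV/= in_itv/= -ler_norml
    -(sqrtr_sqr s) ler_sqrt// lerBrDr//.
have b0 : 0 <= b by exact: sqrtr_ge0.
have [b0'|bn0] := eqVneq b 0.
  by rewrite b0' oppr0 set_itv1 integral_set1.
have bpos : 0 < b by rewrite lt_neqAle eq_sym bn0.
have dG (t : R) : is_derive t (1 : R) (fun u : R => F (cons_rV (u, y))) (f (cons_rV (t, y))).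
  have := dF (cons_rV (0, y)) t; rewrite update_cons_rV0.
  by under eq_fun do rewrite update_cons_rV0.
have cG (t : R) : {for t, continuous (fun u : R => F (cons_rV (u, y)))}.
  by apply: differentiable_continuous; apply/derivable1_diffP; have [] := dG t.
rewrite (@continuous_FTC2 _ _ (fun u => F (cons_rV (u, y)))).
- rewrite !F0 ?subee// sumsq_cons_rV/= ?sqrrN b2; ring.
- lra.
- apply: continuous_subspaceT => s; apply: continuous_comp; last exact: cf.
  exact: continuous_cons_rVl.
- split=> [t _||].
  + by have [] := dG t.
  + by apply: cvg_at_right_filter; exact: cG.
  + by apply: cvg_at_left_filter; exact: cG.
- by move=> t _; rewrite derive1E; have [_ ->] := dG t.
Qed.

End BallIntegrationByParts.
Arguments sumsq_le {R} n c.

(** * Polynomial functions and Green's identity *)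

Section PolynomialFunctions.
Context {R : realType} {d : nat}.
Local Notation mp := (mpoly.mpoly d R).
Local Notation X i := (mpoly.mpolyX R (mpoly.mnm1 (n := d) i)).
Local Notation D i := (mpoly.mderiv (n := d) (R := R) i).
Implicit Types (P Q F G : mp) (x : 'rV[R]_d).

Lemma pevalD P Q x : peval (P + Q) x = peval P x + peval Q x.
Proof. exact: mpoly.mevalD. Qed.

Lemma pevalM P Q x : peval (P * Q) x = peval P x * peval Q x.
Proof. exact: mpoly.mevalM. Qed.

Lemma pevalZ c P x : peval (c *: P) x = c * peval P x.
Proof. exact: mpoly.mevalZ. Qed.

Lemma pevalXn P n x : peval (P ^+ n) x = peval P x ^+ n.
Proof. exact: (rmorphXn (mpoly.meval (fun i => x ord0 i))). Qed.

Lemma peval_sum n (P : 'I_n -> mp) x :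
  peval (\sum_(i < n) P i) x = \sum_(i < n) peval (P i) x.
Proof. exact: (raddf_sum (mpoly.meval (fun i => x ord0 i))). Qed.

Lemma peval_norm_sqr x : peval norm_sqr x = enorm x ^+ 2.
Proof.
rewrite /norm_sqr peval_sum sqr_enorm; apply: eq_bigr => i _.
by rewrite pevalXn /peval mpoly.mevalXU.
Qed.

Lemma peval_homog k P c x : P \is mpoly.ishomog1 k mpoly.mdeg ->
  peval P (c *: x) = c ^+ k * peval P x.
Proof.
move=> hP; rewrite /peval !mpoly.mevalE mulr_sumr [LHS]big_seq [RHS]big_seq.
apply: eq_bigr => m mP; rewrite -(mpoly.dhomog_mf hP mP) /= mpoly.mdegE.
rewrite -prodrXr mulrCA -big_split; congr (_ * _); apply: eq_bigr => i _.
by rewrite mxE exprMn.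
Qed.

Lemma peval_homog0 k P : P \is mpoly.ishomog1 k mpoly.mdeg -> (0 < k)%N ->
  peval P 0 = 0.
Proof. by move=> hP k0; rewrite -(scale0r 0) (peval_homog _ _ hP) expr0n gtn_eqF// mul0r. Qed.

Lemma peval_direction k P x : P \is mpoly.ishomog1 k mpoly.mdeg ->
  peval P x = enorm x ^+ k * peval P (direction x).
Proof. by move=> hP; rewrite -(peval_homog _ _ hP) enormM_direction. Qed.

Lemma continuous_peval P : continuous (peval P : 'rV[R]_d -> R).
Proof.
elim/mpoly_ring_ind: P => [c|i|P Q cP cQ|P Q cP cQ].
- have -> : peval (mpoly.mpolyC d c) = (fun=> c) :> ('rV[R]_d -> R).
    by apply/funext => x; rewrite /peval mpoly.mevalC.
  exact: cst_continuous.
- have -> : peval (X i) = (fun x => x ord0 i) :> ('rV[R]_d -> R).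
    by apply/funext => x; rewrite /peval mpoly.mevalXU.
  exact: coord_continuous.
- rewrite (_ : peval (P + Q) = (fun x => peval P x + peval Q x)).
    exact: continuous_addr.
  by apply/funext => x; rewrite pevalD.
- rewrite (_ : peval (P * Q) = (fun x => peval P x * peval Q x)).
    exact: continuous_mulr.
  by apply/funext => x; rewrite pevalM.
Qed.

Lemma is_derive_peval P x i (t : R) :
  is_derive t (1 : R) (fun u : R => peval P (update_rV x i u))
    (peval (D i P) (update_rV x i t)).
Proof.
elim/mpoly_ring_ind: P => [c|j|P Q dP dQ|P Q dP dQ].
- have -> : (fun u : R => peval (mpoly.mpolyC d c) (update_rV x i u)) = cst c.
    by apply/funext => u; rewrite /peval mpoly.mevalC.
  rewrite mpoly.mderivC /peval mpoly.meval0; exact: is_derive_cst.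
- have E u : peval (X j) (update_rV x i u) = if j == i then u else x ord0 j.
    by rewrite /peval mpoly.mevalXU mxE.
  rewrite mderivXU (eq_sym i j); under eq_fun do rewrite E.
  case: eqP => _.
    by rewrite /peval mpoly.meval1; exact: is_derive_id.
  by rewrite /peval mpoly.meval0; exact: is_derive_cst.
- rewrite mpoly.mderivD pevalD; under eq_fun do rewrite pevalD.
  exact: is_deriveD.
- rewrite mpoly.mderivM pevalD !pevalM; under eq_fun do rewrite pevalM.
  apply: is_derive_eq (is_deriveM dP dQ) _.
  by rewrite /GRing.scale/= addrC (mulrC (peval Q _)).
Qed.

Lemma mderivXn P n i : D i (P ^+ n.+1) = P ^+ n * D i P *+ n.+1.
Proof.
elim: n => [|n IHn]; first by rewrite !expr1 expr0 mul1r.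
rewrite exprS mpoly.mderivM IHn mulrnAr mulrA -exprS mulrC.
by rewrite [in RHS]mulrS.
Qed.

(** The field F grad G - G grad F has divergence 0 for harmonic F and G, so only the gradient of the
    weight contributes, namely -2 (n+1) |x|^(2n) x, and Euler's identity turns its product with the
    field into a multiple of F G. As the weight vanishes on the unit sphere, integrating over the
    ball shows that |x|^(2n) F G has integral 0 whenever the degrees differ. *)
Lemma green_identity k j n F G : solid_harmonic k F -> solid_harmonic j G ->
  \sum_(i < d) D i ((F * D i G - G * D i F) * (1 - norm_sqr ^+ n.+1)) =
  ((n.+1 * 2)%:R * (k%:R - j%:R)) *: (norm_sqr ^+ n * (F * G)).
Proof.
move=> [hF lapF] [hG lapG].
have [eF eG] := (euler_identity hF, euler_identity hG).
have -> : \sum_(i < d) D i ((F * D i G - G * D i F) * (1 - norm_sqr ^+ n.+1)) =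
    \sum_(i < d) ((1 - norm_sqr ^+ n.+1) * F * D i (D i G)
      - (1 - norm_sqr ^+ n.+1) * G * D i (D i F)
      + ((n.+1 * 2)%:R * norm_sqr ^+ n * G * (X i * D i F)
      - (n.+1 * 2)%:R * norm_sqr ^+ n * F * (X i * D i G))).
  apply: eq_bigr => i _; rewrite !(mpoly.mderivM, mpoly.mderivB) mderivXn.
  rewrite mderiv_norm_sqr -mpoly.mpolyC1 mpoly.mderivC sub0r mpoly.mpolyC1.
  suff aux (A : comNzRingType) (f g f' g' f'' g'' a s p : A) (N : nat) :
     (f' * g' + f * g'' - (g' * f' + g * f'')) * (1 - s) +
     (f * g' - g * f') * - (p * (a *+ 2) *+ N) =
     (1 - s) * f * g'' - (1 - s) * g * f'' +
     ((N * 2)%:R * p * g * (a * f') - (N * 2)%:R * p * f * (a * g')).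
    exact: aux.
  rewrite natrM -mulr_natr; ring.
rewrite !big_split/= !sumrN -!mulr_sumr eF eG.
rewrite -/(laplacian F) -/(laplacian G) lapF lapG !mulr0 subrr add0r.
rewrite -mpoly.mul_mpolyC mpoly.mpolyCM mpoly.mpolyCB !rmorph_nat.
suff aux (A : comNzRingType) (f g p N : A) : N * p * g * (f *+ k) -
    N * p * f * (g *+ j) = N * (k%:R - j%:R) * (p * (f * g)) by exact: aux.
by rewrite -(mulr_natr f k) -(mulr_natr g j); ring.
Qed.

End PolynomialFunctions.

(** * Orthogonality of spherical harmonics *)

Section InverseSquareRoot.
Variable R : realType.

(* Newton's iteration for the inverse square root. *)
Fixpoint inv_sqrt_poly n : {poly R} :=
  if n is n'.+1 then
    let w := inv_sqrt_poly n' in 2^-1 *: (w * (3%:P - 'X * w ^+ 2))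
  else 1.

Let y n (t : R) := t * (inv_sqrt_poly n).[t ^+ 2].

Let yS n t : y n.+1 t = y n t * (3 - y n t ^+ 2) / 2.
Proof.
rewrite /y /= !(hornerZ, hornerM, hornerD, hornerN, hornerC, hornerX, horner_exp).
by move: (inv_sqrt_poly n).[_] => w; field.
Qed.

(** The product [y n t] follows the iteration u -> u (3 - u^2) / 2, which on [0, 1] increases
    towards its fixed point 1, starting from t. *)
Lemma inv_sqrt_poly_bounds n t : 0 <= t <= 1 ->
  t <= t * (inv_sqrt_poly n).[t ^+ 2] <= 1.
Proof.
move=> /andP[t0 t1]; rewrite -/(y n t); elim: n => [|n IHn].
  by rewrite /y /= hornerE mulr1 lexx.
rewrite yS; move: IHn => /andP[]; move: (y n t) => u u0 u1.
have h1 : 0 <= u * (1 - u) * (1 + u) by rewrite !mulr_ge0//; lra.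
have h2 : 0 <= (1 - u) * (1 - u) * (2 + u) by rewrite !mulr_ge0//; lra.
have -> : u * (3 - u ^+ 2) / 2 = u + u * (1 - u) * (1 + u) / 2 by field.
have -> : u + u * (1 - u) * (1 + u) / 2 = 1 - (1 - u) * (1 - u) * (2 + u) / 2 by field.
apply/andP; split; last lra.
have -> : 1 - (1 - u) * (1 - u) * (2 + u) / 2 = u + u * (1 - u) * (1 + u) / 2 by field.
lra.
Qed.

(** The defect satisfies 1 - u (3 - u^2) / 2 = (1 - u) (1 - (u + u^2) / 2), and u >= t bounds the
    second factor by 1 - t / 2. The explicit rate is what later makes the approximation of |t|
    uniform. *)
Lemma inv_sqrt_poly_rate n t : 0 <= t <= 1 ->
  1 - t * (inv_sqrt_poly n).[t ^+ 2] <= (1 - t / 2) ^+ n.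
Proof.
move=> t01; have /andP[t0 t1] := t01; rewrite -/(y n t).
elim: n => [|n IHn]; first by rewrite /y /= hornerE mulr1 expr0; lra.
have := inv_sqrt_poly_bounds n t01; rewrite -/(y n t) yS [(1 - t / 2) ^+ n.+1]exprS.
move: IHn; move: (y n t) ((1 - t / 2) ^+ n) => u v uv /andP[u0 u1].
apply: (@le_trans _ _ ((1 - t / 2) * (1 - u))); last first.
  by apply: ler_wpM2l => //; lra.
have h1 : 0 <= (1 - u) * (u - t) by rewrite mulr_ge0//; lra.
have h2 : 0 <= (1 - u) * (u * u) by rewrite !mulr_ge0//; lra.
rewrite -subr_ge0.
have -> : (1 - t / 2) * (1 - u) - (1 - u * (3 - u ^+ 2) / 2) =
  ((1 - u) * (u - t) + (1 - u) * (u * u)) / 2 by field.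
by lra.
Qed.

Lemma inv_sqrt_poly_cvg t : 0 <= t <= 1 -> t != 0 ->
  t * (inv_sqrt_poly n).[t ^+ 2] @[n --> \oo] --> (1 : R).
Proof.
move=> t01 tn0; have /andP[t0 t1] := t01.
have tpos : 0 < t by rewrite lt_neqAle eq_sym tn0.
have /cvgrPdist_le cvg0 : (1 - t / 2) ^+ n @[n --> \oo] --> (0 : R).
  by apply: cvg_expr; rewrite ger0_norm; lra.
apply/cvgrPdist_le => e e0; near=> n.
have /andP[_ y1] := inv_sqrt_poly_bounds n t01.
rewrite ger0_norm ?subr_ge0//; apply: le_trans (inv_sqrt_poly_rate n t01) _.
have : `|0 - (1 - t / 2) ^+ n| <= e by near: n; exact: cvg0.
by rewrite sub0r normrN => /(le_trans (ler_norm _)).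
Unshelve. all: by end_near. Qed.

End InverseSquareRoot.

(** * From integrals over the ball to integrals over the sphere *)

Section SphericalIntegral.
Context {R : realType} {d : nat}.
Notation sfm := {sigma_finite_measure set (borel_rV R d) -> \bar R}.
Implicit Types (m : sfm) (F G : mpoly.mpoly d R).

Let ball1 : set (borel_rV R d) := eball 1.
Let mball1 : measurable ball1. Proof. exact: borel_eball. Qed.

Lemma ball1E : ball1 = sumsq_le d (1 : R).
Proof. by rewrite sumsq_le_eball// sqrtr1. Qed.

Lemma continuous_bounded_measurable_eball (r : R) (f : 'rV[R]_d -> R) :
  continuous f -> bounded_measurable (eball r : set (borel_rV R d)) f.
Proof.
move=> cf; apply: continuous_bounded_measurable.
- exact: compact_eball.
- exact: borel_eball.
- exact: continuous_subspaceT.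
Qed.

Lemma continuous_horner_sqr_enorm (p : {poly R}) :
  continuous (fun x : 'rV[R]_d => p.[enorm x ^+ 2]).
Proof.
move=> x; apply: (@continuous_comp _ _ _ (fun x : 'rV[R]_d => enorm x ^+ 2) (horner p)).
  exact: continuous_sqr_enorm.
exact: continuous_horner.
Qed.

Let ball1_lty m : @lebesgue_rV R d = m -> (m ball1 < +oo)%E.
Proof. by move=> mE; rewrite ball1E; exact: lebesgue_rV_sumsq_le_lty. Qed.

Lemma integral_ball_harmonic m k j n F G : @lebesgue_rV R d = m -> k <> j ->
  solid_harmonic k F -> solid_harmonic j G ->
  Rintegral m ball1 (fun x => peval (norm_sqr ^+ n * (F * G)) x) = 0.
Proof.
move=> mE kj hF hG.
pose V i := (F * mpoly.mderiv i G - G * mpoly.mderiv i F) * (1 - norm_sqr ^+ n.+1).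
have bV i : bounded_measurable ball1 (peval (mpoly.mderiv i (V i))).
  by apply: continuous_bounded_measurable_eball; exact: continuous_peval.
have V0 i : Rintegral m ball1 (peval (mpoly.mderiv i (V i))) = 0.
  have Vz (x : 'rV[R]_d) : \sum_j x ord0 j ^+ 2 = 1 -> peval (V i) x = 0.
    move=> x1; rewrite /V pevalM.
    suff -> : peval (1 - norm_sqr ^+ n.+1) x = 0 by rewrite mulr0.
    rewrite -scaleN1r pevalD pevalZ pevalXn peval_norm_sqr sqr_enorm x1 expr1n.
    by rewrite /peval mpoly.meval1 mulr1 subrr.
  rewrite /Rintegral ball1E.
  by rewrite (integral_ball_partial0 mE (@continuous_peval _ _ _)
    (fun x t => is_derive_peval (V i) x i t) Vz).
have dsum : (fun x => \sum_(i < d) peval (mpoly.mderiv i (V i)) x) =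
    (fun x => (n.+1 * 2)%:R * (k%:R - j%:R) * peval (norm_sqr ^+ n * (F * G)) x).
  by apply/funext => x; rewrite -peval_sum (green_identity n hF hG) pevalZ.
have c0 : (n.+1 * 2)%:R * (k%:R - j%:R) != 0 :> R.
  by rewrite mulf_neq0 ?pnatr_eq0// subr_eq0 eqr_nat; apply/eqP.
apply/(mulfI c0); rewrite mulr0 -RintegralZl//; last first.
  apply: bounded_measurable_integrable; [exact: mball1|exact: ball1_lty|].
  by apply: continuous_bounded_measurable_eball; exact: continuous_peval.
rewrite -dsum Rintegral_bounded_sum//; last exact: ball1_lty.
by rewrite big1.
Qed.

Lemma integral_ball_harmonic_poly m k j (q : {poly R}) F G :
  @lebesgue_rV R d = m -> k <> j -> solid_harmonic k F -> solid_harmonic j G ->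
  Rintegral m ball1 (fun x => q.[enorm x ^+ 2] * (peval F x * peval G x)) = 0.
Proof.
move=> mE kj hF hG.
have -> : (fun x => q.[enorm x ^+ 2] * (peval F x * peval G x)) = fun x =>
    \sum_(i < size q) q`_i * peval (norm_sqr ^+ i * (F * G)) x.
  apply/funext => x; rewrite horner_coef mulr_suml; apply: eq_bigr => i _.
  by rewrite (pevalM _ (F * G)) (pevalM F) pevalXn peval_norm_sqr -!mulrA.
have bm (i : nat) : bounded_measurable ball1 (peval (norm_sqr ^+ i * (F * G))).
  by apply: continuous_bounded_measurable_eball; exact: continuous_peval.
rewrite (Rintegral_bounded_sum mball1 (ball1_lty mE)); last first.
  by move=> i; apply: bounded_measurableZ => //; exact: bm.
rewrite big1// => i _; rewrite RintegralZl//.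
  by rewrite (integral_ball_harmonic _ mE kj hF hG) mulr0.
by apply: bounded_measurable_integrable => //; exact: ball1_lty.
Qed.

Lemma measurable_direction :
  measurable_fun setT (direction : borel_rV R d -> borel_rV R d).
Proof.
have minv : measurable_fun setT (GRing.inv : R -> R).
  rewrite -(setUv [set 0]); apply/measurable_funU => //.
    by apply: measurableC.
  split; first exact: measurable_fun_set1.
  apply: open_continuous_measurable_fun.
    by rewrite openC; exact: (@closed_eq R).
  by move=> t; rewrite inE => /eqP t0; exact: inv_continuous.
apply: measurable_rVP => i; under eq_fun do rewrite /direction mxE.
apply: measurable_funM.
  by apply: (measurableT_comp minv); apply: continuous_measurable_rV; exact: continuous_enorm.
by apply: continuous_measurable_rV; exact: coord_continuous.
Qed.

Lemma enorm_direction_le1 (x : 'rV[R]_d) : enorm (direction x) <= 1.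
Proof.
have [->|x0] := eqVneq x 0; last by rewrite enorm_direction.
by rewrite /direction scaler0 (_ : enorm 0 = 0) ?ler01//; apply/eqP; rewrite enorm_eq0.
Qed.

Lemma bounded_measurable_direction (D : set (borel_rV R d)) (g : 'rV[R]_d -> R) :
  measurable D -> continuous g -> bounded_measurable D (g \o direction).
Proof.
move=> mD cg; split.
  apply: measurable_funTS; apply: (measurableT_comp (continuous_measurable_rV cg)).
  exact: measurable_direction.
have [_ [M hM]] := continuous_bounded_measurable_eball 1 cg.
by exists M => x _; apply: hM; exact: enorm_direction_le1.
Qed.

(** The integrand is |x|^-(k+j) F G. Replacing 1/|x| by the polynomials w_n(|x|^2) gives integrals
    that are 0; as |x| w_n(|x|^2) stays in [0, 1] and tends to 1 off the origin, bounded convergence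
    applies. *)
Lemma integral_direction_harmonic m k j F G : @lebesgue_rV R d = m -> k <> j ->
  solid_harmonic k F -> solid_harmonic j G ->
  Rintegral m ball1 (fun x => peval F (direction x) * peval G (direction x)) = 0.
Proof.
move=> mE kj hF hG.
pose q n : {poly R} := inv_sqrt_poly R n ^+ (k + j).
pose H n (x : borel_rV R d) := (q n).[enorm x ^+ 2] * (peval F x * peval G x).
have cFG : continuous (fun x => peval F x * peval G x).
  by apply: continuous_mulr; exact: continuous_peval.
have [mFG [M hM]] := @bounded_measurable_direction ball1 _ mball1 cFG.
have HE n x : H n x = (enorm x * (inv_sqrt_poly R n).[enorm x ^+ 2]) ^+ (k + j) *
    (peval F (direction x) * peval G (direction x)).
  rewrite /H (peval_direction _ hF.1) (peval_direction _ hG.1) /q horner_exp.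
  by rewrite exprMn !exprD; ring.
have H0 n : Rintegral m ball1 (H n) = 0.
  exact: (integral_ball_harmonic_poly (q n) mE kj hF hG).
have : Rintegral m ball1 (H n) @[n --> \oo] -->
    Rintegral m ball1 (fun x => peval F (direction x) * peval G (direction x)).
  apply: (@Rintegral_bounded_cvg _ _ _ _ mball1 _ _ _ M).
  - exact: ball1_lty.
  - move=> n; have [] // : bounded_measurable ball1 (H n).
    apply: continuous_bounded_measurable_eball; apply: continuous_mulr => //.
    exact: continuous_horner_sqr_enorm.
  - exact: mFG.
  - move=> n x x1; rewrite HE normrM -[leRHS]mul1r ler_pM//; last exact: hM.
    have /andP[] := inv_sqrt_poly_bounds n (introT andP (conj (enorm_ge0 x) x1)).
    move=> /(le_trans (enorm_ge0 x)) y0 y1.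
    by rewrite normrX ger0_norm// exprn_ile1.
  - move=> x x1; under eq_fun do rewrite HE.
    (* At the origin both sides vanish, since the product has degree k + j > 0 for [k <> j]. *)
    have [->|x0] := eqVneq x 0.
      suff -> : peval F (direction 0) * peval G (direction 0) = 0.
        by under eq_fun do rewrite mulr0; exact: cvg_cst.
      rewrite /direction scaler0 -pevalM.
      apply: (@peval_homog0 _ _ (k + j)); last by case: (k) (j) kj => [|?] [].
      by apply: mpoly.dhomogM; [case: hF|case: hG].
    set c := peval F _ * peval G _.
    suff : (enorm x * (inv_sqrt_poly R n).[enorm x ^+ 2]) ^+ (k + j) * c
        @[n --> \oo] --> 1 ^+ (k + j) * c by rewrite expr1n mul1r.
    apply: cvgM; last exact: cvg_cst.
    apply: (continuous_cvg _ (@exprn_continuous _ (k + j) 1)).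
    apply: inv_sqrt_poly_cvg; last by rewrite enorm_eq0.
    by rewrite enorm_ge0.
under eq_fun do rewrite H0.
by move/cvg_lim => <- //; rewrite lim_cst.
Qed.

(** The union of all cones measured by [surface_measure]; without the origin, [direction] maps it
    into the sphere. *)
Definition punctured_ball : set (borel_rV R d) :=
  [set x : 'rV[R]_d | 0 < enorm x <= 1].

Lemma measurable_punctured_ball : measurable punctured_ball.
Proof.
have -> : punctured_ball = eball 1 `&` ~` eball 0.
  apply/seteqP; split=> x /=; rewrite /punctured_ball /eball/=.
    by move=> /andP[x0 x1]; split=> //; apply/negP; rewrite -ltNge.
  by move=> [x1 /negP]; rewrite -ltNge => x0; rewrite x0 x1.
by apply: measurableI; [|apply: measurableC]; exact: borel_eball.
Qed.

Lemma punctured_ball_lty m : @lebesgue_rV R d = m -> (m punctured_ball < +oo)%E.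
Proof.
move=> mE; apply: le_lt_trans (ball1_lty mE); apply: le_measure; rewrite ?inE//.
  exact: measurable_punctured_ball.
by move=> x /= /andP[].
Qed.

Lemma closed_esphere : closed (esphere : set 'rV[R]_d).
Proof.
rewrite (_ : esphere = enorm @^-1` [set t | t = 1]); last by [].
by apply: closed_comp => [x _|]; [exact: continuous_enorm|exact: closed_eq].
Qed.

(** By its definition through cones, the surface measure is d times the image of Lebesgue measure on
    the punctured ball under x -> x/|x|. *)
Lemma integral_surface_measure m (g : 'rV[R]_d -> R) : @lebesgue_rV R d = m ->
  continuous g ->
  (\int[@surface_measure R d]_(x in esphere) (g x)%:E =
   (d%:R * Rintegral m punctured_ball (g \o direction))%:E)%E.
Proof.
move=> mE cg; have mB0 := measurable_punctured_ball.
(* Points outside the punctured ball are sent to 0, off the sphere, so that the preimage of the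
   sphere is exactly the punctured ball. *)
pose phi (x : borel_rV R d) : borel_rV R d :=
  if x \in punctured_ball then direction x else 0.
have phiE (x : 'rV[R]_d) : punctured_ball x -> phi x = direction x.
  by move=> Bx; rewrite /phi mem_set.
have mphi : measurable_fun setT phi.
  apply: measurable_fun_ifT => //.
    apply: (measurable_fun_bool true).
    rewrite setTI [X in measurable X](_ : _ = punctured_ball)//.
    by apply/seteqP; split=> x; [exact: set_mem | exact: mem_set].
  exact: measurable_direction.
have phi_sphere : phi @^-1` esphere = punctured_ball.
  apply/seteqP; split=> x /=; rewrite /phi /esphere/=.
    case: ifPn => [|_]; first by rewrite inE.
    by move/eqP; rewrite (_ : enorm 0 = 0) ?(eq_sym 0) ?oner_eq0//;
      apply/eqP; rewrite enorm_eq0.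
  move=> Bx; rewrite mem_set// enorm_direction//.
  by move: Bx => /andP[x0 _]; rewrite -enorm_eq0 gt_eqF.
have [P PE] : exists P : {measure set (borel_rV R d) -> \bar R},
    (P : set (borel_rV R d) -> \bar R) = pushforward m phi.
  pose Q : {measure set (borel_rV R d) -> \bar R} :=
    [the measure _ _ of pushforward m phi].
  by exists (Q mphi).
have msph : measurable (esphere : set (borel_rV R d)) by apply: borel_closed; exact: closed_esphere.
have [S SE] : exists S : {measure set (borel_rV R d) -> \bar R},
    (S : set (borel_rV R d) -> \bar R) = @surface_measure R d.
  pose Q : {measure set (borel_rV R d) -> \bar R} :=
    [the measure _ _ of pushforward (mrestr m mB0)
      (direction : borel_rV R d -> borel_rV R d)].
  exists (mscale (NngNum (ler0n R d)) (Q measurable_direction)).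
  apply/funext => A; rewrite /surface_measure /mscale/= mE; congr (_ * m _)%E.
  apply/seteqP; split=> x /=; first by move=> [Adx /andP[x0 x1]].
  by move=> [x0 x1 Adx]; split=> //; apply/andP.
have surfE : (\int[@surface_measure R d]_(x in esphere) (g x)%:E =
    \int[mscale (NngNum (ler0n R d)) P]_(x in esphere) (g x)%:E)%E.
  rewrite -SE; apply: eq_measure_integral => A mA Asph.
  have -> : S A = @surface_measure R d A by rewrite SE.
  have PA : P A = m (phi @^-1` A) by exact: (congr1 (fun h => h A) PE).
  rewrite -[RHS]/(d%:R%:E * P A)%E PA /surface_measure mE; congr (_ * m _)%E.
  apply/seteqP; split=> x /=.
    by move=> [x0 x1 Adx]; rewrite phiE// /punctured_ball/= x0 x1.
  move=> Aphix; have Bx : punctured_ball x by rewrite -phi_sphere; exact: Asph.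
  by move: Aphix; rewrite phiE//; move: Bx => /andP[].
have mgT : measurable_fun (setT : set (borel_rV R d)) g by exact: continuous_measurable_rV.
have mg : measurable_fun (esphere : set (borel_rV R d)) (EFin \o g).
  by apply/measurable_EFinP; exact: measurable_funTS.
have intg0 : m.-integrable punctured_ball (EFin \o (g \o direction)).
  apply: bounded_measurable_integrable => //; first exact: punctured_ball_lty.
  exact: bounded_measurable_direction.
have intg1 : m.-integrable (phi @^-1` esphere) ((EFin \o g) \o phi).
  rewrite phi_sphere; apply: eq_integrable intg0 => // x.
  by rewrite inE => Bx /=; rewrite phiE.
have intPg : P.-integrable esphere (EFin \o g).
  have := integrable_pushforward mphi ((measurable_EFinP _ _).2 mgT) intg1 msph.
  by rewrite -PE.
have PgE : (\int[P]_(x in esphere) (g x)%:E =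
    \int[m]_(x in punctured_ball) (g (direction x))%:E)%E.
  transitivity (\int[pushforward m phi]_(x in esphere) (EFin \o g) x)%E.
    by apply: eq_measure_integral => A _ _; exact: (congr1 (fun h => h A) PE).
  rewrite integral_pushforward//; last exact/measurable_EFinP.
  by rewrite phi_sphere; apply: eq_integral => x; rewrite inE => Bx /=; rewrite phiE.
rewrite surfE integralE.
rewrite ge0_integral_mscale//; last exact: measurable_funepos.
rewrite ge0_integral_mscale//; last exact: measurable_funeneg.
rewrite -muleBr//; last first.
  apply: fin_num_adde_defl; rewrite fin_numN.
  exact/(integrable_fin_num msph)/integrable_funeneg.
rewrite -integralE PgE /Rintegral EFinM fineK//.
exact: integrable_fin_num intg0.
Qed.

(** Removing the origin changes nothing, as the integrand is 0 there. *)
Lemma integral_punctured_ball_harmonic m k j F G : @lebesgue_rV R d = m ->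
  k <> j -> solid_harmonic k F -> solid_harmonic j G ->
  Rintegral m punctured_ball
    (fun x => peval F (direction x) * peval G (direction x)) = 0.
Proof.
move=> mE kj hF hG; rewrite -(integral_direction_harmonic mE kj hF hG).
rewrite Rintegral_mkcond [RHS]Rintegral_mkcond; congr (Rintegral m setT _).
apply/funext => x; rewrite !patchE.
have [->|x0] := eqVneq x (0 : 'rV[R]_d).
  suff -> : peval F (direction 0) * peval G (direction 0) = 0 by rewrite !if_same.
  rewrite /direction scaler0 -pevalM.
  apply: (@peval_homog0 _ _ (k + j)); last by case: (k) (j) kj => [|?] [].
  by apply: mpoly.dhomogM; [case: hF|case: hG].
congr (if _ then _ else _); apply/idP/idP; rewrite !inE /punctured_ball /ball1 /eball/=.
  by case/andP.
by move=> ->; rewrite lt_neqAle enorm_ge0 eq_sym enorm_eq0 x0.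
Qed.

End SphericalIntegral.

(* For theta on the sphere, P (t theta) is the sum of the p k l (t ^ 2) t ^ k
   Y k l (theta), so the left-hand side is a Fourier coefficient of
   theta |-> P (t theta) on the sphere, and |Y| <= (1 + Y ^ 2) / 2. *)
Lemma harmonic_coefficient_bound (R : realType) (d : nat) (a : nat -> nat)
    (Y : forall k : nat, 'I_(a k) -> mpoly.mpoly d R) :
  orthonormal_harmonic_basis Y ->
  exists2 C : R, 0 <= C &
    forall (K : nat) (p : forall k : nat, 'I_(a k) -> {poly R})
      (P : 'rV[R]_d -> R) (r B : R), continuous P ->
    (forall x, P x =
      \sum_(k < K) \sum_(l < a k) (p k l).[enorm x ^+ 2] * peval (Y k l) x) ->
    (forall x, enorm x <= r -> `|P x| <= B) ->
    forall k (l : 'I_(a k)) t, (k < K)%N -> 0 <= t <= r ->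
      `|(p k l).[t ^+ 2]| * t ^+ k <= C * B.
Proof.
move=> hY; have [m mE _] := @lebesgue_rV_measure R d.
pose B0 := @punctured_ball R d.
have mB0 : measurable B0 by exact: measurable_punctured_ball.
have B0oo : (m B0 < +oo)%E by exact: punctured_ball_lty.
have hdir x : B0 x -> enorm (direction x) = 1.
  by case/andP=> x0 _; rewrite enorm_direction// -enorm_eq0 gt_eqF.
have bYY k l k' l' : bounded_measurable B0
    (fun x => peval (Y k l) (direction x) * peval (Y k' l') (direction x)).
  apply: (@bounded_measurable_direction _ _ _
    (fun x => peval (Y k l) x * peval (Y k' l') x)) => //.
  by apply: continuous_mulr; exact: continuous_peval.
have intb f : bounded_measurable B0 f -> m.-integrable B0 (EFin \o f).
  exact: bounded_measurable_integrable.
have ortho k (l l' : 'I_(a k)) : d%:R * Rintegral m B0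
    (fun x => peval (Y k l) (direction x) * peval (Y k l') (direction x)) =
    (l == l')%:R.
  have [_ _ /(_ l l')] := hY k; rewrite (integral_surface_measure mE) => [[]//|].
  by apply: continuous_mulr; exact: continuous_peval.
(* Here d times the volume of the punctured ball is the area of the sphere and 1 is the integral of
   Y^2; half of the sum bounds the integral of |Y|. *)
exists ((d%:R * fine (m B0) + 1) / 2).
  by rewrite divr_ge0// addr_ge0// mulr_ge0// fine_ge0// measure_ge0.
move=> K p P r B cP PE PB k l t kK /andP[t0 tr].
pose g (x : borel_rV R d) := P (t *: direction x).
have bg : bounded_measurable B0 g.
  apply: (@bounded_measurable_direction _ _ _ (fun x => P (t *: x))) => //.
  by move=> x; apply: continuous_comp; [exact: scaler_continuous|exact: cP].
have bY : bounded_measurable B0 (fun x => peval (Y k l) (direction x)).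
  apply: (@bounded_measurable_direction _ _ _ (peval (Y k l))) => //.
  exact: continuous_peval.
have gB x : B0 x -> `|g x| <= B.
  by move=> Bx; rewrite PB// enormZ ger0_norm// hdir// mulr1.
have coefE : d%:R * Rintegral m B0 (fun x => g x * peval (Y k l) (direction x)) =
    (p k l).[t ^+ 2] * t ^+ k.
  have -> : Rintegral m B0 (fun x => g x * peval (Y k l) (direction x)) =
      Rintegral m B0 (fun x => \sum_(k' < K) \sum_(l' < a k')
        (p k' l').[t ^+ 2] * t ^+ k' *
        (peval (Y k' l') (direction x) * peval (Y k l) (direction x))).
    apply: eq_Rintegral => x; rewrite inE => Bx; rewrite /g PE mulr_suml.
    apply: eq_bigr => k' _; rewrite mulr_suml; apply: eq_bigr => l' _.
    have [/(_ l')[hom _] _ _] := hY k'.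
    by rewrite (peval_homog _ _ hom) enormZ hdir// mulr1 ger0_norm// !mulrA.
  rewrite Rintegral_bounded_sum//; last first.
    move=> k'; apply: bounded_measurable_sum => // l'.
    exact: bounded_measurableZ.
  have sumE k' : Rintegral m B0 (fun x => \sum_(l' < a k')
        (p k' l').[t ^+ 2] * t ^+ k' *
        (peval (Y k' l') (direction x) * peval (Y k l) (direction x))) =
      \sum_(l' < a k') (p k' l').[t ^+ 2] * t ^+ k' * Rintegral m B0
        (fun x => peval (Y k' l') (direction x) * peval (Y k l) (direction x)).
    rewrite (Rintegral_bounded_sum mB0 B0oo).
      by apply: eq_bigr => l' _; rewrite RintegralZl//; exact: intb.
    by move=> l'; exact: bounded_measurableZ.
  under eq_bigr => k' _ do rewrite sumE.
  (* Green's identity removes the other degrees; within degree k, the assumed orthonormality then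
     isolates the index l. *)
  rewrite (bigD1 (Ordinal kK))//= [X in _ + X]big1 ?addr0; last first.
    move=> k' k'k; apply: big1 => l' _.
    rewrite (integral_punctured_ball_harmonic mE (k := k') (j := k)) ?mulr0//.
    - by move/eqP: k'k => k'k kk'; apply: k'k; exact: val_inj.
    - by have [/(_ l')] := hY k'.
    - by have [/(_ l)] := hY k.
  rewrite mulr_sumr (bigD1 l)//= [X in _ + X]big1 ?addr0; last first.
    by move=> l' l'l; rewrite mulrCA ortho (negPf l'l) mulr0.
  by rewrite mulrCA ortho eqxx mulr1.
have -> : `|(p k l).[t ^+ 2]| * t ^+ k = `|(p k l).[t ^+ 2] * t ^+ k|.
  by rewrite normrM (ger0_norm (exprn_ge0 k t0)).
rewrite -coefE normrM ger0_norm//.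
have B_ge0 : 0 <= B.
  rewrite (le_trans (normr_ge0 (P 0)))// PB// (_ : enorm 0 = 0) ?(le_trans t0)//.
  by apply/eqP; rewrite enorm_eq0.
have bgY := bounded_measurableM bg bY.
have bsq : bounded_measurable B0 (fun x => 1 + peval (Y k l) (direction x) *
    peval (Y k l) (direction x)).
  by apply: bounded_measurableD => //; exact: bounded_measurable_cst.
have bnd : `|Rintegral m B0 (fun x => g x * peval (Y k l) (direction x))| <=
    B / 2 * (fine (m B0) + Rintegral m B0
      (fun x => peval (Y k l) (direction x) * peval (Y k l) (direction x))).
  rewrite (le_trans (le_normr_Rintegral mB0 (intb _ bgY)))//.
  rewrite -[X in X + _]mul1r -(Rintegral_cst m mB0) -RintegralD//; first last.
  - exact: intb.
  - by apply: intb; exact: bounded_measurable_cst.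
  rewrite -RintegralZl//; last exact: intb.
  apply: le_Rintegral => //.
  - apply: intb; case: bgY => mgY [M hM]; split; first exact: measurableT_comp.
    by exists M => x Bx; rewrite normr_id hM.
  - by apply: intb; exact: bounded_measurableZ.
  move=> x Bx; rewrite normrM mulrAC -mulrA.
  apply: ler_pM => //; first exact: gB.
  rewrite -[X in 1 + X]expr2 -[in leRHS](real_normK (num_real _)).
  by move: (`|peval _ _|) => y; rewrite ler_pdivlMr//; have := sqr_ge0 (y - 1); lra.
rewrite (le_trans (ler_wpM2l (ler0n _ d) bnd))// mulrCA mulrDr ortho eqxx.
by rewrite le_eqVlt; apply/orP; left; apply/eqP; rewrite mulr1n; field.
Qed.

(** * Polynomial approximation on compact sets *)

Section PolynomialApproximation.
Context {R : realType} {d : nat}.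
Variable K : set 'rV[R]_d.
Hypothesis compactK : compact K.
Implicit Types f g : 'rV[R]_d -> R.

Definition polynomially_approximable f :=
  forall e : R, 0 < e -> exists P : mpoly.mpoly d R,
    forall x, K x -> `|f x - peval P x| <= e.

Let bounded_peval P : exists2 M : R, 0 < M & forall x, K x -> `|peval P x| <= M.
Proof.
have cP : {within K, continuous (peval P : 'rV[R]_d -> R)}.
  by apply: continuous_subspaceT; exact: continuous_peval.
have := continuous_compact cP compactK => /compact_bounded[M [_ hM]].
exists (`|M| + 1); first by rewrite ltr_wpDl.
move=> x Kx; apply: (hM (`|M| + 1)); last by exists x.
by rewrite (le_lt_trans (ler_norm M))// ltrDl.
Qed.

Lemma peval_horner (p : {poly R}) (Q : mpoly.mpoly d R) :
  exists P : mpoly.mpoly d R, forall x, peval P x = p.[peval Q x].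
Proof.
elim/poly_ind: p => [|p c [P PE]].
  by exists 0 => x; rewrite horner0 /peval mpoly.meval0.
exists (P * Q + mpoly.mpolyC d c) => x.
by rewrite pevalD pevalM PE hornerMXaddC /peval mpoly.mevalC.
Qed.

Lemma approximable_peval P : polynomially_approximable (peval P).
Proof. by move=> e e0; exists P => x _; rewrite subrr normr0 ltW. Qed.

Lemma approximable_cst c : polynomially_approximable (fun=> c).
Proof.
move=> e e0; exists (mpoly.mpolyC d c) => x _.
by rewrite /peval mpoly.mevalC subrr normr0 ltW.
Qed.

Lemma approximable_limit f : (forall e : R, 0 < e ->
    exists2 g, polynomially_approximable g & forall x, K x -> `|f x - g x| <= e) ->
  polynomially_approximable f.
Proof.
move=> h e e0; have e20 : 0 < e / 2 by rewrite divr_gt0.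
have [g ag fg] := h _ e20; have [P gP] := ag _ e20.
exists P => x Kx; rewrite (le_trans (ler_distD (g x) _ _))//.
by rewrite [leRHS](splitr e) lerD ?fg ?gP.
Qed.

Lemma approximableD f g : polynomially_approximable f ->
  polynomially_approximable g -> polynomially_approximable (fun x => f x + g x).
Proof.
move=> af ag e e0; have e20 : 0 < e / 2 by rewrite divr_gt0.
have [P fP] := af _ e20; have [Q gQ] := ag _ e20.
exists (P + Q) => x Kx; rewrite pevalD opprD addrACA (le_trans (ler_normD _ _))//.
by rewrite [leRHS](splitr e) lerD ?fP ?gQ.
Qed.

Lemma approximableZ c f : polynomially_approximable f ->
  polynomially_approximable (fun x => c * f x).
Proof.
move=> af e e0; have c0 : 0 < `|c| + 1 by rewrite ltr_wpDl.
have [P fP] := af _ (divr_gt0 e0 c0).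
exists (c *: P) => x Kx; rewrite pevalZ -mulrBr normrM.
apply: (@le_trans _ _ ((`|c| + 1) * (e / (`|c| + 1)))).
  by apply: ler_pM => //; [rewrite lerDl | exact: fP].
by rewrite mulrCA divff ?gt_eqF// mulr1.
Qed.

(** Convergence of the iteration is slow near 0, but the error t (1 - t w(t^2)) carries a factor t
    that compensates: t (1 - t/2)^n is of order 1/n uniformly on [0, 1]. *)
Lemma normr_sub_inv_sqrt (t : R) n : `|t| <= 1 ->
  `| `|t| - t ^+ 2 * (inv_sqrt_poly R n).[t ^+ 2]| <= 2 / n.+1%:R.
Proof.
move=> t1; rewrite -(real_normK (num_real t)); move: (normr_ge0 t) t1.
move: (`|t|) => {}t t0 t1; have t01 : 0 <= t <= 1 by rewrite t0.
have -> : t - t ^+ 2 * (inv_sqrt_poly R n).[t ^+ 2] =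
    t * (1 - t * (inv_sqrt_poly R n).[t ^+ 2]) by ring.
have /andP[_ y1] := inv_sqrt_poly_bounds n t01.
rewrite normrM !ger0_norm ?subr_ge0//.
apply: (@le_trans _ _ (t * (1 - t / 2) ^+ n)).
  by apply: ler_wpM2l => //; exact: inv_sqrt_poly_rate.
(* A form of Bernoulli's inequality. *)
have key k : (1 + k%:R * (t / 2)) * (1 - t / 2) ^+ k <= 1.
  elim: k => [|k IHk]; first by rewrite mul0r addr0 expr0 mulr1.
  apply: le_trans IHk; rewrite exprS [leLHS]mulrA; apply: ler_wpM2r.
    by rewrite exprn_ge0//; lra.
  rewrite -[k.+1%:R]natr1; have : 0 <= k%:R * (t / 2) * (t / 2) by rewrite !mulr_ge0//; lra.
  have : 0 <= (t / 2) * (t / 2) by rewrite !mulr_ge0//; lra.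
  lra.
have v0 : 0 <= (1 - t / 2) ^+ n by rewrite exprn_ge0//; lra.
have v1 : (1 - t / 2) ^+ n <= 1 by rewrite exprn_ile1//; lra.
rewrite ler_pdivlMr//; have := key n; rewrite -[n.+1%:R]natr1.
move: v0 v1; move: ((1 - t / 2) ^+ n) => v v0 v1.
have : t * v <= v by rewrite -[leRHS]mul1r ler_wpM2r.
lra.
Qed.

(** After replacing f by a polynomial P and dividing by a bound M of |P| on K, the values lie in
    [-1, 1], where |t| is uniformly a limit of polynomials in t^2. Minima become available in this
    way. *)
Lemma approximable_norm f : polynomially_approximable f ->
  polynomially_approximable (fun x => `|f x|).
Proof.
move=> af; apply: approximable_limit => e e0; have [P fP] := af _ e0.
exists (fun x => `|peval P x|); last first.
  by move=> x Kx; rewrite (le_trans (ler_dist_dist _ _))// fP.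
move=> {e e0 fP} e e0; have [M M0 PM] := bounded_peval P.
have [n nE] : exists n : nat, 2 * M / e <= n.+1%:R.
  exists (Num.Def.archi_bound (2 * M / e)).
  apply/ltW/(lt_trans (archi_boundP _)); last by rewrite ltr_nat.
  by rewrite divr_ge0 ?mulr_ge0// ltW.
have [Q QE] := peval_horner ('X * inv_sqrt_poly R n) ((M^-1 *: P) ^+ 2).
exists (M *: Q) => x Kx; rewrite pevalZ QE hornerM hornerX pevalXn pevalZ.
have -> : `|peval P x| = M * `|M^-1 * peval P x|.
  by rewrite normrM gtr0_norm ?invr_gt0// mulVKf ?gt_eqF.
rewrite -mulrBr normrM gtr0_norm//.
have u1 : `|M^-1 * peval P x| <= 1.
  by rewrite normrM gtr0_norm ?invr_gt0// mulrC ler_pdivrMr// mul1r PM.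
apply: (@le_trans _ _ (M * (2 / n.+1%:R))).
  by apply: ler_wpM2l; [exact: ltW | exact: normr_sub_inv_sqrt].
rewrite mulrA ler_pdivrMr// mulrC [leRHS]mulrC -ler_pdivrMr//.
Qed.

Lemma approximable_min f g : polynomially_approximable f ->
  polynomially_approximable g -> polynomially_approximable (fun x => Num.min (f x) (g x)).
Proof.
move=> af ag.
have -> : (fun x => Num.min (f x) (g x)) =
    (fun x => 2^-1 * ((f x + g x) + -1 * `|f x + -1 * g x|)).
  by apply/funext => x; rewrite mulN1r minr_absE mulN1r mulrC.
apply: approximableZ; apply: approximableD; first exact: approximableD.
by apply: approximableZ; apply: approximable_norm; apply: approximableD => //;
  exact: approximableZ.
Qed.

Lemma approximable_sum n (F : 'I_n -> 'rV[R]_d -> R) :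
  (forall i, polynomially_approximable (F i)) ->
  polynomially_approximable (fun x => \sum_(i < n) F i x).
Proof.
elim: n F => [|n IHn] F aF.
  move=> e e0; exists 0 => x _.
  by rewrite big_ord0 /peval mpoly.meval0 subrr normr0 ltW.
under eq_fun do rewrite big_ord_recr; apply: approximableD => //.
exact: (IHn (fun i => F (widen_ord (leqnSn n) i))).
Qed.

Let cone (c L : R) (y x : 'rV[R]_d) := c + L * \sum_(i < d) `|x ord0 i - y ord0 i|.

Let approximable_cone c L y : polynomially_approximable (cone c L y).
Proof.
apply: approximableD; first exact: approximable_cst.
apply: approximableZ; apply: approximable_sum => i.
apply: approximable_norm; apply: approximableD; last exact: approximable_cst.
have -> : (fun x : 'rV[R]_d => x ord0 i) = peval (mpoly.mpolyX R (mpoly.mnm1 i)).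
  by apply/funext => x; rewrite /peval mpoly.mevalXU.
exact: approximable_peval.
Qed.

(* f is the infimum, up to e, of finitely many steep cones lying above it. *)
Theorem weierstrass_approximation f : {within K, continuous f} ->
  polynomially_approximable f.
Proof.
move=> cf; apply: approximable_limit => e e0.
have [M hM] : exists M : R, forall x, K x -> `|f x| <= M.
  have := continuous_compact cf compactK => /compact_bounded[M [_ hM]].
  by exists (M + 1) => x Kx; apply: (hM (M + 1)); [rewrite ltrDl | exists x].
have coney y : K y -> exists L : R, forall x, K x -> f x <= cone (f y + e / 4) L y x.
  move=> Ky; have /subspace_continuousP/(_ y Ky)/cvgrPdist_lt/(_ (e / 4)) := cf.
  rewrite divr_gt0// => /(_ isT); rewrite near_withinE => /nbhs_ballP[r /= r0 hr].
  have M0 : 0 <= M by rewrite (le_trans _ (hM _ Ky)).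
  (* With this slope the cone has risen by at least 2 M once some coordinate differs by r, which
     exceeds any variation of f; closer to y, continuity keeps f below the apex. *)
  exists (2 * M / r) => x Kx; rewrite /cone.
  have [xy|] := pselect (forall i, `|x ord0 i - y ord0 i| < r).
    have : `|f y - f x| < e / 4.
      apply: hr => //; split=> // i j; rewrite ord1 /ball/= distrC; exact: xy.
    rewrite ltr_norml => /andP[fxy _].
    have : 0 <= 2 * M / r * \sum_(i < d) `|x ord0 i - y ord0 i|.
      by rewrite mulr_ge0 ?sumr_ge0// divr_ge0 ?mulr_ge0// ltW.
    lra.
  move=> /existsNP[i /negP]; rewrite -leNgt => ri.
  have : 2 * M <= 2 * M / r * \sum_(i < d) `|x ord0 i - y ord0 i|.
    rewrite mulrAC ler_pdivlMr// ler_wpM2l ?mulr_ge0//.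
    by rewrite (le_trans ri)// (bigD1 i)//= lerDl sumr_ge0.
  by have := hM _ Kx; have := hM _ Ky; rewrite !ler_norml; lra.
have [L LP] : exists L : 'rV[R]_d -> R, forall y, K y ->
    forall x, K x -> f x <= cone (f y + e / 4) (L y) y x.
  have /choice[L LP] : forall y, exists l : R, K y ->
      forall x, K x -> f x <= cone (f y + e / 4) l y x.
    by move=> y; have [/coney[l hl]|] := pselect (K y); [exists l | exists 0].
  by exists L.
pose h y := cone (f y + e / 4) (L y) y.
have ch y : continuous (h y).
  apply: continuous_addr; first exact: cst_continuous.
  apply: continuous_mulr; first exact: cst_continuous.
  apply: continuous_sumr => i; apply: continuous_normr.
  by apply: continuous_addr; [exact: coord_continuous|exact: cst_continuous].
(* Where the cone with apex y is a good enough upper bound. This is a neighbourhood of y, the cone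
   being only e/4 above f at y itself. *)
pose V y := [set x | K x -> h y x <= f x + e].
have nbhsV y : K y -> nbhs y (V y).
  move=> Ky; have /subspace_continuousP/(_ y Ky)/cvgrPdist_lt/(_ (e / 4)) := cf.
  rewrite divr_gt0// => /(_ isT); rewrite near_withinE => nf.
  have /cvgrPdist_lt/(_ (e / 4)) := ch y y; rewrite divr_gt0// => /(_ isT) nh.
  apply: filterS2 nf nh => x /= hf; rewrite /h /cone => hh Kx; move: hh (hf Kx).
  have -> : \sum_(i < d) `|y ord0 i - y ord0 i| = 0.
    by apply: big1 => i _; rewrite subrr normr0.
  rewrite !ltr_norml mulr0 /from_subspace /h /cone.
  by move=> /andP[h1 h2] /andP[f1 f2]; lra.
have cover_approx (s : seq 'rV[R]_d) : {subset s <= K} ->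
    exists g, [/\ polynomially_approximable g, forall x, K x -> f x <= g x &
      forall y x, y \in s -> K x -> g x <= h y x].
  elim: s => [_|y s IHs ys].
    exists (fun=> M); split=> // [|x Kx].
      exact: approximable_cst.
    by rewrite (le_trans (ler_norm _))// hM.
  have [|g [ag fg gh]] := IHs; first by move=> z zs; apply: ys; rewrite inE zs orbT.
  have Ky : K y by apply/set_mem/ys; rewrite mem_head.
  exists (fun x => Num.min (h y x) (g x)); split.
  - by apply: approximable_min => //; exact: approximable_cone.
  - by move=> x Kx; rewrite le_min fg// LP.
  - move=> z x; rewrite inE ge_min => /predU1P[->|zs] Kx; first by rewrite lexx.
    by rewrite gh// orbT.
have /(_ _ K (fun y => (V y)^°)) : cover_compact K by rewrite -compact_cover.
case=> [y _|x Kx|D DK Kcov]; first exact: open_interior.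
  by exists x => //; exact: nbhsV.
have [|g [ag fg gh]] := cover_approx (finmap.enum_fset D); first by move=> y /DK.
exists g => // x Kx; have [y yD /interior_subset hy] := Kcov _ Kx.
rewrite distrC ger0_norm ?subr_ge0 ?fg// lerBlDl.
by rewrite (le_trans (gh y x yD Kx))// hy.
Qed.

End PolynomialApproximation.

(** * Complex values and supports *)

Section ComplexValues.
Variable R : realType.
Local Open Scope complex_scope.

Lemma normr_real_complex (x : R) : `|x%:C| = `|x|%:C.
Proof. by rewrite normc_def /= expr0n addr0 sqrtr_sqr. Qed.

Lemma normr_Re_le (z : R[i]) : `|complex.Re z|%:C <= `|z|.
Proof.
case: z => x y; rewrite normc_def lecR /= -(sqrtr_sqr x) ler_sqrt ?lerDl ?sqr_ge0//.
by rewrite addr_ge0 ?sqr_ge0.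
Qed.

Lemma normr_Im_le (z : R[i]) : `|complex.Im z|%:C <= `|z|.
Proof.
case: z => x y; rewrite normc_def lecR /= -(sqrtr_sqr y) ler_sqrt ?lerDr ?sqr_ge0//.
by rewrite addr_ge0 ?sqr_ge0.
Qed.

Lemma normr_complex_le (z : R[i]) :
  `|z| <= (`|complex.Re z| + `|complex.Im z|)%:C.
Proof.
case: z => x y; rewrite normc_def lecR /=.
rewrite -[leRHS](ger0_norm (addr_ge0 (normr_ge0 x) (normr_ge0 y))) -sqrtr_sqr.
rewrite ler_sqrt ?sqr_ge0// sqrrD !real_normK ?num_real// lerD2r lerDl.
by rewrite mulrn_wge0// mulr_ge0.
Qed.

Lemma posc_Re (e : R[i]) : 0 < e -> exists2 x : R, 0 < x & e = x%:C.
Proof.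
by case: e => x y; rewrite ltcE /= => /andP[/eqP -> x0]; exists x.
Qed.

Lemma cvg_complex (T : Type) (F : set_system T) (FF : Filter F)
    (f : T -> R[i]^o) (l : R[i]^o) :
  complex.Re (f t) @[t --> F] --> complex.Re l ->
  complex.Im (f t) @[t --> F] --> complex.Im l -> f t @[t --> F] --> l.
Proof.
move=> /cvgrPdist_lt cr /cvgrPdist_lt ci; apply/cvgrPdist_lt => _ /posc_Re[e e0 ->].
have e20 : 0 < e / 2 by rewrite divr_gt0.
apply: filterS2 (cr _ e20) (ci _ e20) => t hr hi.
apply: (le_lt_trans (normr_complex_le _)); rewrite ltcR.
rewrite [ltRHS](splitr e) ltrD//.
  by move: hr; case: l (f t) {cr ci hi} => [? ?] [? ?].
by move: hi; case: l (f t) {cr ci hr} => [? ?] [? ?].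
Qed.

Lemma cvg_Re (T : Type) (F : set_system T) (FF : Filter F)
    (f : T -> R[i]^o) (l : R[i]^o) :
  f t @[t --> F] --> l -> complex.Re (f t) @[t --> F] --> complex.Re l.
Proof.
move=> /cvgrPdist_lt cf; apply/cvgrPdist_lt => e e0.
have := cf e%:C; rewrite -[0]/(0%:C) ltcR => /(_ e0).
apply: filterS => t; rewrite -ltcR; apply: le_lt_trans.
by apply: le_trans (normr_Re_le _); rewrite lecR; case: l (f t) {cf} => [? ?] [? ?].
Qed.

Lemma cvg_Im (T : Type) (F : set_system T) (FF : Filter F)
    (f : T -> R[i]^o) (l : R[i]^o) :
  f t @[t --> F] --> l -> complex.Im (f t) @[t --> F] --> complex.Im l.
Proof.
move=> /cvgrPdist_lt cf; apply/cvgrPdist_lt => e e0.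
have := cf e%:C; rewrite -[0]/(0%:C) ltcR => /(_ e0).
apply: filterS => t; rewrite -ltcR; apply: le_lt_trans.
by apply: le_trans (normr_Im_le _); rewrite lecR; case: l (f t) {cf} => [? ?] [? ?].
Qed.

Lemma continuous_real_complex (T : topologicalType) (h : T -> R) :
  continuous h -> continuous (fun t => (h t)%:C : R[i]^o).
Proof. by move=> ch t; apply: cvg_complex => /=; [exact: ch | exact: cvg_cst]. Qed.

Lemma map_real_complex_laplacian d (P : mpoly.mpoly d R) n :
  iter n laplacian (mpoly.map_mpoly (real_complex R) P) =
  mpoly.map_mpoly (real_complex R) (iter n laplacian P).
Proof.
elim: n => //= n ->; move: (iter _ _ _) => {}P; rewrite /laplacian raddf_sum.
apply: eq_bigr => i _; apply/mpoly.mpolyP => m.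
rewrite mpoly.mcoeff_map_mpoly !mpoly.mcoeff_mderiv mpoly.mcoeff_map_mpoly.
by rewrite !raddfMn.
Qed.

Lemma cpeval_map_real_complex d (P : mpoly.mpoly d R) x :
  cpeval (mpoly.map_mpoly (real_complex R) P) x = (peval P x)%:C.
Proof.
elim/mpoly_ring_ind: P => [c|i|P Q IHP IHQ|P Q IHP IHQ].
- by rewrite mpoly.map_mpolyC /cpeval /peval !mpoly.mevalC.
- by rewrite mpoly.map_mpolyX /cpeval /peval !mpoly.mevalXU.
- by rewrite pevalD !rmorphD/= -IHP -IHQ /cpeval mpoly.mevalD.
- by rewrite pevalM !rmorphM/= -IHP -IHQ /cpeval mpoly.mevalM.
Qed.

End ComplexValues.

Section SupportInBall.
Context {R : realType} {d : nat}.
Variables (nu : {charge set (borel_rV R d) -> \bar R}) (r : R).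
Hypothesis nu_supp : measure_support nu `<=` eball r.

Lemma charge_null_outside_ball (A : set (borel_rV R d)) :
  measurable A -> A `<=` ~` eball r -> nu A = 0%E.
Proof.
have [B [bB _]] := countable_base_rV R d.
move=> mA Ar; apply: (measure_support_null bB) => //.
- move=> F0 mF tF F00; pose F : nat -> set (borel_rV R d) := F0.
  have := @charge_semi_sigma_additive _ _ _ nu F mF tF (bigcupT_measurable F mF).
  rewrite (_ : (fun n => \sum_(0 <= i < n) nu (F i))%E = cst 0%E); last first.
    by apply/funext => n; rewrite big1.
  by move/cvg_lim => <- //; rewrite lim_cst.
- exact: charge0.
- by move=> x /Ar xr /nu_supp.
Qed.

Lemma signed_integral_ball (f : borel_rV R d -> R) : measurable_fun setT f ->
  signed_integral nu setT f = signed_integral nu (eball r) f.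
Proof.
apply: signed_integral_setT; first exact: borel_eball.
exact: charge_null_outside_ball.
Qed.

End SupportInBall.

(** * Finitely supported measures on the half-line and quadrature *)

Section FiniteSupport.
Variables (R : realType) (nu : {measure set (measurableTypeR R) -> \bar R}).

Lemma borel_R_open (A : set R) : <<s @open R >> A -> measurable (A : set (measurableTypeR R)).
Proof. by apply: smallest_sub => [|U oU]; [exact: sigma_algebra_measurable|exact: open_measurable]. Qed.

Lemma closed_seq (S : seq R) : closed [set` S].
Proof.
apply: (accessible_finite_set_closed.1 (hausdorff_accessible (@Rhausdorff R))).
exact: finite_seq.
Qed.

Lemma finite_support_seq s : (measure_support (nu : set R -> \bar R) #<= `I_s)%card ->
  exists S : seq R, [/\ uniq S, (size S <= s)%N & nu (~` [set` S]) = 0%E].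
Proof.
move=> Ss; have : finite_set (measure_support (nu : set R -> \bar R)).
  by apply: card_le_finite Ss _; exact: finite_II.
move=> [n Sn]; have ns : (n <= s)%N.
  by rewrite -card_le_II; apply: card_le_trans Ss; rewrite card_eq_le in Sn; case/andP: Sn.
have /card_set_bijP[f [_ _ fsurj]] : (`I_n #= measure_support (nu : set R -> \bar R))%card.
  by rewrite card_eq_sym.
exists (undup (map f (iota 0 n))); split; first exact: undup_uniq.
  by rewrite (leq_trans (size_undup _))// size_map size_iota.
have [B bB] := countable_base_R R.
apply: (measure_support_null bB) => //.
- move=> F0 mF tF F00; pose F : nat -> set (measurableTypeR R) := F0.
  have mF' k : measurable (F k : set (measurableTypeR R)) by exact: borel_R_open.
  have := @measure_semi_sigma_additive _ _ _ nu F mF' tF (bigcupT_measurable F mF').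
  rewrite (_ : (fun n => \sum_(0 <= i < n) nu (F i))%E = cst 0%E); last first.
    by apply/funext => k; rewrite big1.
  by move/cvg_lim => <- //; rewrite lim_cst.
- by apply: sub_sigma_algebra; apply: closed_openC; exact: closed_seq.
- move=> x /= xS /fsurj[i /= ni fx]; apply: xS; rewrite /= mem_undup -fx.
  by apply/map_f; rewrite mem_iota.
Qed.

End FiniteSupport.

Lemma Rintegral_finite_support (R : realType)
    (nu : {measure set (measurableTypeR R) -> \bar R})
    (S : seq R) (A : set (measurableTypeR R)) (h : R -> R) :
  measurable A -> (nu A < +oo)%E -> uniq S -> nu (~` [set` S]) = 0%E ->
  measurable_fun A h ->
  Rintegral nu A h = \sum_(s <- S) Rintegral nu A (\1_[set s]) * h s.
Proof.
move=> mA Aoo uS nuS mh.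
have bindic i : bounded_measurable A (\1_[set S`_i] : measurableTypeR R -> R).
  split; first exact: measurable_indic.
  by exists 1 => x _; rewrite indicE; case: (_ \in _); rewrite ?normr0 ?normr1.
transitivity (Rintegral nu A (fun x => \sum_(i < size S) h S`_i * \1_[set S`_i] x)).
  congr fine; apply: ae_eq_integral => //.
  - exact/measurable_EFinP.
  - apply/measurable_EFinP.
    have [] // := @bounded_measurable_sum _ _ R A (size S)
      (fun i x => h S`_i * \1_[set S`_i] x).
    by move=> i; exact: bounded_measurableZ.
  - exists (~` [set` S]); split => //.
      by apply: measurableC; apply: closed_measurable; exact: closed_seq.
    move=> x /=; apply: contra_not => xS _; congr (EFin _).
    have xi : (index x S < size S)%N by rewrite index_mem.
    rewrite (bigD1 (Ordinal xi))//= nth_index// indicE mem_set// mulr1.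
    rewrite big1 ?addr0// => i ix; rewrite indicE memNset ?mulr0//= => xE.
    by move/eqP: ix; apply; apply: val_inj; rewrite /= xE index_uniq.
rewrite Rintegral_bounded_sum//; last by move=> i; exact: bounded_measurableZ.
rewrite (big_nth 0) big_mkord; apply: eq_bigr => i _.
rewrite RintegralZl ?(mulrC (h _))//.
exact: bounded_measurable_integrable.
Qed.

Section Quadrature.
Context {R : realType} {d : nat}.
Local Open Scope complex_scope.

Definition growth_bounded (h : R -> R) :=
  exists (C : R) (m : nat), forall t, 0 <= t -> `|h t| <= C * (1 + t ^+ m).

(** A component measure with finite support is a finite combination of point masses. The weights do
    not depend on h, and they are non-negative because the component measure is. *)
Lemma component_quadrature (a : nat -> nat)
    (Y : forall k : nat, 'I_(a k) -> mpoly.mpoly d R)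
    (sigma : {charge set (borel_rV R d) -> \bar R})
    k (l : 'I_(a k)) (nu : {measure set (measurableTypeR R) -> \bar R}) s :
  component_measure Y sigma l nu ->
  (measure_support (nu : set R -> \bar R) #<= `I_s)%card ->
  exists (S : seq R) (w : R -> R), [/\ (size S <= s)%N,
    forall t, t \in S -> 0 <= t, forall t, 0 <= w t &
    forall h : R -> R, continuous h -> growth_bounded h ->
      signed_integral sigma setT (fun x => h (enorm x) * peval (Y k l) x) =
      \sum_(t <- S) w t * h t].
Proof.
move=> [nu_neg nuh] nu_supp.
have [S [uS Ss nuS]] := finite_support_seq nu_supp.
pose A : set (measurableTypeR R) := [set t : R | 0 <= t].
have mA : measurable A by apply: closed_measurable; exact: closed_ge.
have real_nuh (h : R -> R) : continuous h -> growth_bounded h ->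
    nu.-integrable A (fun t => (h t)%:E) /\
    signed_integral sigma setT (fun x => h (enorm x) * peval (Y k l) x) =
      Rintegral nu A h.
  move=> ch [C [m hC]]; pose hc t : R[i]^o := (h t)%:C.
  have [||int_re _ []] := nuh hc.
  - by apply: continuous_subspaceT; exact: continuous_real_complex.
  - by exists C, m => t t0; rewrite normr_real_complex lecR hC.
  move=> nuE _; split=> //; rewrite nuE.
  by congr signed_integral; apply/funext => x /=; rewrite mul0r subr0.
(* Finiteness follows from the integrability of the constant test function 1. *)
have Aoo : (nu A < +oo)%E.
  have c1 : continuous (fun _ : R => 1 : R) by exact: cst_continuous.
  have [|/integrableP[_ int1] _] := real_nuh _ c1.
    by exists 1, 0%N => t _; rewrite normr1 mul1r expr0 lerDl.
  apply: le_lt_trans int1; under eq_integral do rewrite gee0_abs ?lee_fin//.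
  by rewrite integral_cst// mul1e.
exists [seq t <- S | 0 <= t], (fun t => Rintegral nu A (\1_[set t])); split.
- by rewrite size_filter (leq_trans (count_size _ _)).
- by move=> t; rewrite mem_filter => /andP[].
- by move=> t; apply: Rintegral_ge0 => x _ /=; rewrite /indic ler0n.
- move=> h ch gh; have [inth ->] := real_nuh h ch gh.
  rewrite (Rintegral_finite_support mA Aoo uS nuS); last first.
    by apply/measurable_EFinP; exact: measurable_int inth.
  rewrite big_filter [RHS]big_mkcond; apply: eq_bigr => t _.
  case: ifPn => // t0; rewrite (_ : Rintegral _ _ _ = 0) ?mul0r//.
  rewrite (@eq_Rintegral _ _ _ nu A (fun=> 0)) ?Rintegral_cst ?mul0r// => x.
  rewrite inE => /= x0; rewrite /indic memNset//= => xt.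
  by move: t0; rewrite -xt x0.
Qed.

End Quadrature.

(** * Pseudo-positive measures and Gauss-Jacobi nodes *)

Section PseudoPositiveIntegrals.
Context {R : realType} {d : nat} {a : nat -> nat}.
Variable Y : forall k : nat, 'I_(a k) -> mpoly.mpoly d R.
Hypothesis hY : orthonormal_harmonic_basis Y.
Variable r : R.
Hypothesis r_gt0 : 0 < r.
Let B : set (borel_rV R d) := eball r.
Let mB : measurable B. Proof. exact: borel_eball. Qed.
Let bm_continuous (f : 'rV[R]_d -> R) : continuous f -> bounded_measurable B f.
Proof. exact: continuous_bounded_measurable_eball. Qed.

Lemma continuous_maxr (T : topologicalType) (f g : T -> R) :
  continuous f -> continuous g -> continuous (fun t => Num.max (f t) (g t)).
Proof. by move=> cf cg; exact: max_fun_continuous. Qed.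

Lemma continuous_radial (h : R -> R) : continuous h ->
  continuous (fun x : 'rV[R]_d => h (enorm x)).
Proof.
move=> ch x; apply: (@continuous_comp _ _ _ (enorm : 'rV[R]_d -> R) h).
  exact: continuous_enorm.
exact: ch.
Qed.

Lemma continuous_radialM (h : R -> R) P : continuous h ->
  continuous (fun x : 'rV[R]_d => h (enorm x) * peval P x).
Proof.
by move=> ch; apply: continuous_mulr; [exact: continuous_radial|exact: continuous_peval].
Qed.

Lemma bounded_measurable_peval_direction P :
  bounded_measurable B (fun x => peval P (direction x)).
Proof.
by apply: (@bounded_measurable_direction _ _ _ (peval P)) => //; exact: continuous_peval.
Qed.

Section OneCharge.
Variable mu : {charge set (borel_rV R d) -> \bar R}.
Hypothesis mu_pos : pseudo_positive Y mu.
Hypothesis mu_supp : measure_support mu `<=` eball r.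

(** Pseudo-positivity speaks of compactly supported functions that are non-negative on the whole
    half-line. Since mu lives on the ball, h may be replaced by its positive part times a cutoff
    that equals 1 up to r and vanishes from r + 1 on. *)
Lemma radial_integral_ge0 (h : R -> R) k (l : 'I_(a k)) : continuous h ->
  (forall t, 0 <= t <= r -> 0 <= h t) ->
  0 <= signed_integral mu B (fun x => h (enorm x) * peval (Y l) x).
Proof.
move=> ch h0.
pose g t := Num.max (h t) 0 * Num.max (1 + -1 * Num.max (t - r) 0) 0.
have cg : continuous g.
  apply: continuous_mulr; apply: continuous_maxr; try exact: cst_continuous.
    exact: ch.
  apply: continuous_addr; first exact: cst_continuous.
  apply: continuous_mulr; first exact: cst_continuous.
  apply: continuous_maxr; last exact: cst_continuous.
  by apply: continuous_addr => [t|]; [exact: cvg_id|exact: cst_continuous].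
have gE : signed_integral mu setT (fun x => g (enorm x) * peval (Y l) x) =
    signed_integral mu B (fun x => h (enorm x) * peval (Y l) x).
  rewrite (signed_integral_ball mu_supp); last first.
    by apply: continuous_measurable_rV; exact: continuous_radialM.
  apply: eq_signed_integral => x xr; rewrite /g max_l ?h0 ?enorm_ge0//.
  have -> : Num.max (enorm x - r) 0 = 0 by apply: max_r; rewrite subr_le0.
  by rewrite mulr0 addr0 max_l ?mulr1.
rewrite -gE; apply: mu_pos; first exact: continuous_subspaceT.
  by move=> t _; rewrite mulr_ge0// le_max lexx orbT.
exists (r + 1) => t rt; rewrite /g.
suff -> : Num.max (1 + -1 * Num.max (t - r) 0) 0 = 0 by rewrite mulr0.
by apply: max_r; rewrite max_l; lra.
Qed.

(* A minorant q (t ^ 2) of t ^ - k yields a minorant of the integral of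
   Y (x / |x|) = |x| ^ - k Y x; the singularity at 0 is truncated. *)
Lemma integral_minorant_le k (l : 'I_(a k)) (q : {poly R}) : (0 < k)%N ->
  (forall t, 0 < t -> q.[t ^+ 2] <= t ^- k) ->
  signed_integral mu B (fun x => q.[enorm x ^+ 2] * peval (Y l) x) <=
  signed_integral mu B (fun x => peval (Y l) (direction x)).
Proof.
move=> k0 qk; have [hom _] : solid_harmonic k (Y l) by have [/(_ l)] := hY k.
pose m n (t : R) := Num.max t n.+1%:R^-1.
have m_gt0 n t : 0 < m n t by rewrite /m lt_max invr_gt0 ltr0n orbT.
pose h n t := Num.max (m n t ^- k + -1 * q.[t ^+ 2]) 0.
have cq : continuous (fun t : R => q.[t ^+ 2]).
  move=> t; apply: (@continuous_comp _ _ _ (fun t : R => t ^+ 2) (horner q)).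
    exact: exprn_continuous.
  exact: continuous_horner.
have ch n : continuous (h n).
  apply: continuous_maxr; last exact: cst_continuous.
  apply: continuous_addr; last by apply: continuous_mulr => //; exact: cst_continuous.
  move=> t; apply: (@continuous_comp _ _ _ (m n) (fun u => u ^- k)).
    apply: continuous_maxr; last exact: cst_continuous.
    by move=> u; exact: cvg_id.
  apply: (@continuous_comp _ _ _ (fun u : R => u ^+ k) (@GRing.inv R)).
    exact: exprn_continuous.
  by apply: inv_continuous; rewrite expf_neq0// gt_eqF.
have bdir := bounded_measurable_peval_direction (Y l).
have bq : bounded_measurable B (fun x => q.[enorm x ^+ 2] * peval (Y l) x).
  by apply: bm_continuous; apply: (@continuous_radialM (fun t => q.[t ^+ 2])).
rewrite -subr_ge0 -(signed_integralB mB)//.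
have hge0 n : 0 <= signed_integral mu B (fun x => h n (enorm x) * peval (Y l) x).
  by apply: radial_integral_ge0 => // t _; rewrite /h le_max lexx orbT.
have [_ [M1 hM1]] := bdir; have [_ [M2 hM2]] := bq.
suff cvgJ : signed_integral mu B (fun x => h n (enorm x) * peval (Y l) x)
    @[n --> \oo] --> signed_integral mu B
      (fun x => peval (Y l) (direction x) - q.[enorm x ^+ 2] * peval (Y l) x).
  rewrite -(cvg_lim (@Rhausdorff R) cvgJ).
  by apply: limr_ge; [exact: cvgP cvgJ | exact: nearW].
apply: (signed_integral_cvg mB (M := M1 + M2)).
- move=> n; have [] // : bounded_measurable B (fun x => h n (enorm x) * peval (Y l) x).
  by apply: bm_continuous; exact: continuous_radialM.
- by have [] := bounded_measurableB bdir bq.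
- move=> n x Bx; rewrite normrM.
  have [->|x0] := eqVneq x (0 : 'rV[R]_d).
    rewrite (peval_homog0 hom k0) normr0 mulr0.
    by rewrite (le_trans (normr_ge0 (peval (Y l) (direction x) + 0)))// addr0;
      rewrite (le_trans (hM1 _ Bx))// lerDl (le_trans _ (hM2 _ Bx)).
  have x0' : 0 < enorm x by rewrite lt_neqAle eq_sym enorm_eq0 x0 enorm_ge0.
  have hle : `|h n (enorm x)| <= enorm x ^- k + `|q.[enorm x ^+ 2]|.
    rewrite ger0_norm ?le_max ?lexx ?orbT// ge_max addr_ge0 ?invr_ge0 ?exprn_ge0//;
      last exact: ltW.
    rewrite andbT mulN1r lerD//; last by rewrite -normrN ler_norm.
    rewrite lef_pV2 ?posrE ?exprn_gt0//.
    apply: lerXn2r; rewrite ?nnegrE; [exact: ltW|exact: ltW|].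
    by rewrite /m le_max lexx.
  apply: (@le_trans _ _ ((enorm x ^- k + `|q.[enorm x ^+ 2]|) * `|peval (Y l) x|)).
    exact: ler_wpM2r.
  rewrite mulrDl lerD//; last by rewrite -normrM hM2.
  rewrite (peval_direction x hom) normrM (ger0_norm (exprn_ge0 k (enorm_ge0 x))).
  by rewrite mulKf ?expf_neq0 ?gt_eqF//; exact: hM1.
- move=> x Bx; have [->|x0] := eqVneq x (0 : 'rV[R]_d).
    under eq_fun do rewrite (peval_homog0 hom k0) mulr0.
    rewrite /direction scaler0 (peval_homog0 hom k0) mulr0 subr0; exact: cvg_cst.
  have x0' : 0 < enorm x by rewrite lt_neqAle eq_sym enorm_eq0 x0 enorm_ge0.
  apply: cvg_near_cst; near=> n.
  rewrite /h; have -> : m n (enorm x) = enorm x.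
    by apply: max_l; apply: ltW; near: n; exact: near_infty_natSinv_lt (PosNum x0').
  rewrite max_l ?mulN1r ?subr_ge0 ?qk// mulrBl (peval_direction x hom).
  by rewrite mulKf ?expf_neq0 ?gt_eqF.
Unshelve. all: by end_near. Qed.

Lemma integral_direction_ge0 k (l : 'I_(a k)) :
  0 <= signed_integral mu B (fun x => peval (Y l) (direction x)).
Proof.
have [hom _] : solid_harmonic k (Y l) by have [/(_ l)] := hY k.
have [k0|k0] := posnP k; last first.
  have -> : 0 = signed_integral mu B (fun x => (0 : {poly R}).[enorm x ^+ 2] * peval (Y l) x).
    rewrite -(mul0r (signed_integral mu B (fun x => peval (Y l) (direction x)))).
    rewrite -(signed_integralZ mB)//; last exact: bounded_measurable_peval_direction.
    by apply: eq_signed_integral => x _; rewrite horner0 !mul0r.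
  by apply: integral_minorant_le => // t t0; rewrite horner0 invr_ge0 exprn_ge0// ltW.
have := @radial_integral_ge0 (fun=> 1) k l (@cst_continuous _ _ _) (fun _ _ => ler01).
congr (_ <= _); apply: eq_signed_integral => x _.
rewrite mul1r (peval_direction x hom).
have -> : enorm x ^+ k = 1 by rewrite k0 expr0.
by rewrite mul1r.
Qed.

End OneCharge.

Section GaussJacobi.
Variables mu sigma : {charge set (borel_rV R d) -> \bar R}.
Variable s : nat.
Hypothesis s_gt0 : (0 < s)%N.
Hypothesis mu_pos : pseudo_positive Y mu.
Hypothesis mu_supp : measure_support mu `<=` eball r.
Hypothesis sigma_gj : gauss_jacobi Y r mu s sigma.

Let sigma_supp : measure_support sigma `<=` eball r.
Proof. by case: sigma_gj. Qed.

Lemma gauss_jacobi_moment (P : mpoly.mpoly d R) :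
  iter (2 * s) laplacian P = 0 ->
  signed_integral sigma B (peval P) = signed_integral mu B (peval P).
Proof.
move=> lapP; have [_ _ _ /(_ (mpoly.map_mpoly (real_complex R) P))] := sigma_gj.
rewrite map_real_complex_laplacian lapP raddf0 => /(_ erefl) [+ _].
have ReE : (fun x : borel_rV R d =>
    complex.Re (cpeval (mpoly.map_mpoly (real_complex R) P) x)) = peval P.
  by apply/funext => x; rewrite cpeval_map_real_complex.
rewrite ReE -(signed_integral_ball sigma_supp) -1?(signed_integral_ball mu_supp) => [->||]//;
  by apply: continuous_measurable_rV; exact: continuous_peval.
Qed.

Lemma gauss_jacobi_radial_moment (q : {poly R}) k (l : 'I_(a k)) :
  (size q <= 2 * s)%N ->
  signed_integral sigma B (fun x => q.[enorm x ^+ 2] * peval (Y l) x) =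
  signed_integral mu B (fun x => q.[enorm x ^+ 2] * peval (Y l) x).
Proof.
move=> sq; pose P := \sum_(i < size q) q`_i *: (norm_sqr ^+ i * Y l).
have PE : peval P = fun x => q.[enorm x ^+ 2] * peval (Y l) x.
  apply/funext => x; rewrite /P peval_sum horner_coef mulr_suml.
  by apply: eq_bigr => i _; rewrite pevalZ pevalM pevalXn peval_norm_sqr mulrA.
rewrite -PE; apply: gauss_jacobi_moment; rewrite /P.
have hYl : solid_harmonic k (Y l) by have [/(_ l)] := hY k.
elim/big_ind: _ => [|P1 P2 h1 h2|i _].
- exact: iter_laplacian0.
- by rewrite iter_laplacianD h1 h2 addr0.
- rewrite iter_laplacianZ (iter_laplacian_norm_sqrX hYl) ?scaler0//.
  exact: leq_trans (ltn_ord i) sq.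
Qed.

Lemma gauss_jacobi_nodes k (l : 'I_(a k)) :
  exists (S : seq R) (w : R -> R), [/\ (size S <= s)%N,
    forall t, t \in S -> 0 < w t /\ 0 <= t <= r,
    (0 < k)%N -> forall t, t \in S -> 0 < t &
    forall p : {poly R},
      signed_integral sigma B (fun x => p.[enorm x ^+ 2] * peval (Y l) x) =
      \sum_(t <- S) w t * p.[t ^+ 2]].
Proof.
have [_ _ /(_ k l)[nu [nuC nuS]] _] := sigma_gj.
have [S [w [Ss S0 w0 SE]]] := component_quadrature nuC nuS.
have SE' (h : R -> R) : continuous h -> growth_bounded h ->
    signed_integral sigma B (fun x => h (enorm x) * peval (Y l) x) =
    \sum_(t <- S) w t * h t.
  move=> ch gh; rewrite -SE// (signed_integral_ball sigma_supp)//.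
  by apply: continuous_measurable_rV; exact: continuous_radialM.
have hYl : solid_harmonic k (Y l) by have [/(_ l)] := hY k.
have SE0 (h : R -> R) : (forall t, 0 <= t -> 0 <= h t) -> forall t, t \in S ->
    w t * h t <= \sum_(u <- S) w u * h u.
  move=> h0 t tS; rewrite (big_rem t tS)/= lerDl big_seq; apply: sumr_ge0 => u uS.
  by rewrite mulr_ge0// h0// S0// (mem_rem uS).
have node_le t : t \in S -> 0 < w t -> t <= r.
  move=> tS wt; pose h (u : R) := Num.max (u - r) 0.
  have ch : continuous h.
    apply: continuous_maxr; last exact: cst_continuous.
    by apply: continuous_addr => [u|]; [exact: cvg_id|exact: cst_continuous].
  have gh : growth_bounded h.
    exists 1, 1%N => u u0; rewrite mul1r expr1 ger0_norm; last first.
      by rewrite /h le_max lexx orbT.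
    rewrite /h ge_max; apply/andP; split; first by move: r_gt0 u0; lra.
    by move: u0; lra.
  have h0 u : 0 <= u -> 0 <= h u by rewrite /h le_max lexx orbT.
  have := SE0 h h0 t tS; rewrite -SE'//.
  rewrite (@eq_signed_integral _ _ _ B sigma _ (fun x => 0 * peval (Y l) x)); last first.
    by move=> x xr; rewrite /h max_r// subr_le0.
  rewrite signed_integralZ//; last by apply: bm_continuous; exact: continuous_peval.
  rewrite mul0r pmulr_rle0// /h => ht; rewrite leNgt; apply/negP => rt.
  by move: ht; rewrite leNgt lt_max subr_gt0 rt.
have node_gt0 : (0 < k)%N -> 0 \in S -> w 0 <= 0.
  move=> k0 S00; pose h n (u : R) := Num.max (1 + - n.+1%:R * u) 0.
  have ch n : continuous (h n).
    apply: continuous_maxr; last exact: cst_continuous.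
    apply: continuous_addr; first exact: cst_continuous.
    by apply: continuous_mulr => [|u]; [exact: cst_continuous|exact: cvg_id].
  have h1 n u : 0 <= u -> h n u <= 1.
    move=> u0; rewrite /h ge_max ler01 andbT mulNr gerDl oppr_le0.
    by rewrite mulr_ge0.
  have h0 n u : 0 <= u -> 0 <= h n u by rewrite /h le_max lexx orbT.
  have gh n : growth_bounded (h n).
    exists 1, 1%N => u u0; rewrite mul1r expr1 ger0_norm ?h0// (le_trans (h1 n u u0))//.
    by rewrite lerDl.
  have cvgJ : signed_integral sigma B (fun x => h n (enorm x) * peval (Y l) x)
      @[n --> \oo] --> signed_integral sigma B (fun x => 0 * peval (Y l) x).
    have [_ [M hM]] := bm_continuous (@continuous_peval _ _ (Y l)).
    apply: (signed_integral_cvg mB (M := M)).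
    - move=> n; have [] // : bounded_measurable B (fun x => h n (enorm x) * peval (Y l) x).
      by apply: bm_continuous; exact: continuous_radialM.
    - have [] // : bounded_measurable B (fun x => 0 * peval (Y l) x).
      by apply: bm_continuous; apply: (@continuous_radialM (fun=> 0)); exact: cst_continuous.
    - move=> n x Bx; rewrite normrM -[leRHS]mul1r ler_pM//; last exact: hM.
      by rewrite ger0_norm ?h0 ?h1 ?enorm_ge0.
    - move=> x Bx; have [->|x0] := eqVneq x (0 : 'rV[R]_d).
        by under eq_fun do rewrite (peval_homog0 hYl.1 k0) mulr0; rewrite mul0r; exact: cvg_cst.
      have x0' : 0 < enorm x by rewrite lt_neqAle eq_sym enorm_eq0 x0 enorm_ge0.
      apply: cvg_near_cst; near=> n; rewrite /h max_r// mulNr subr_le0.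
      rewrite -ler_pdivrMl// mulr1; apply: ltW; near: n.
      exact: near_infty_natSinv_lt (PosNum x0').
  rewrite signed_integralZ// in cvgJ; last by apply: bm_continuous; exact: continuous_peval.
  rewrite mul0r in cvgJ.
  have wn : \forall n \near \oo, w 0 <=
      signed_integral sigma B (fun x => h n (enorm x) * peval (Y l) x).
    apply: nearW => n; rewrite SE'//; apply: le_trans (SE0 (h n) (h0 n) 0 S00).
    by rewrite /h mulr0 addr0 max_l ?ler01// mulr1.
  by have := limr_ge (cvgP _ cvgJ) wn; rewrite (cvg_lim (@Rhausdorff R) cvgJ); apply.
exists [seq t <- S | 0 < w t], w; split.
- by rewrite size_filter (leq_trans (count_size _ _)).
- by move=> t; rewrite mem_filter => /andP[wt tS]; rewrite wt S0// node_le.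
- move=> k0 t; rewrite mem_filter => /andP[wt tS]; rewrite lt_neqAle S0// andbT.
  by apply/eqP => t0; move: wt; rewrite ltNge -t0 node_gt0// t0.
- move=> p; rewrite (SE' (fun t => p.[t ^+ 2])).
  + rewrite [RHS]big_filter [RHS]big_mkcond; apply: eq_bigr => t _.
    case: ifPn => //; rewrite -leNgt => wt.
    by rewrite (_ : w t = 0) ?mul0r//; apply/eqP; rewrite eq_le wt w0.
  + move=> t; apply: (@continuous_comp _ _ _ (fun t : R => t ^+ 2) (horner p)).
      exact: exprn_continuous.
    exact: continuous_horner.
  + exists (\sum_(i < size p) `|p`_i|), (2 * size p)%N => t t0.
    rewrite horner_coef mulr_suml (le_trans (ler_norm_sum _ _ _))//.
    apply: ler_sum => i _; rewrite normrM; apply: ler_wpM2l => //.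
    rewrite ger0_norm ?exprn_ge0// -exprM; have [t1|t1] := leP t 1.
      by apply: (@le_trans _ _ 1); [exact: exprn_ile1 | rewrite lerDl exprn_ge0].
    rewrite (@le_trans _ _ (t ^+ (2 * size p)))//; last by rewrite lerDr.
    by rewrite ler_weXn2l ?ltW// leq_mul2l /= ltnW.
Unshelve. all: by end_near. Qed.

(* The node polynomial q of t ^ - k turns the sum over the nodes into a moment
   that sigma shares with mu. *)
Lemma gauss_jacobi_radial_bound (p : {poly R}) k (l : 'I_(a k)) (C : R) :
  (forall t, 0 <= t <= r -> `|p.[t ^+ 2]| * t ^+ k <= C) ->
  `|signed_integral sigma B (fun x => p.[enorm x ^+ 2] * peval (Y l) x)| <=
  C * signed_integral mu B (fun x => peval (Y l) (direction x)).
Proof.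
move=> pC; have [S [w [Ss Sw Sk SE]]] := gauss_jacobi_nodes l.
have C0 : 0 <= C.
  have := pC 0; rewrite lexx (ltW r_gt0) => /(_ isT); apply: le_trans.
  by rewrite mulr_ge0// exprn_ge0.
have [q [sq q_le qS]] : exists q : {poly R}, [/\ (size q <= 2 * s)%N,
    signed_integral mu B (fun x => q.[enorm x ^+ 2] * peval (Y l) x) <=
    signed_integral mu B (fun x => peval (Y l) (direction x)) &
    forall t, t \in S -> 0 <= q.[t ^+ 2] /\ q.[t ^+ 2] * t ^+ k = 1].
  have [k0|k0] := posnP k.
    exists 1; split.
    - by rewrite size_poly1; lia.
    - rewrite le_eqVlt; apply/orP; left; apply/eqP; apply: eq_signed_integral => x _.
      have [hom _] : solid_harmonic k (Y l) by have [/(_ l)] := hY k.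
      rewrite hornerC mul1r (peval_direction x hom).
      have -> : enorm x ^+ k = 1 by rewrite k0 expr0.
      by rewrite mul1r.
    - by move=> t _; rewrite hornerC k0 expr0 mulr1.
  have S0 : all (fun v => 0 < v) S by apply/allP; exact: Sk.
  have [q [sq qle qS]] := exprVn_lower_interpolation k S0.
  exists q; split.
  - by rewrite (leq_trans sq)// leq_mul2l Ss.
  - exact: (integral_minorant_le mu_pos mu_supp).
  - move=> t tS; have t0 := Sk k0 t tS; rewrite qS//; split.
      by rewrite invr_ge0 exprn_ge0// ltW.
    by rewrite mulVf// expf_neq0// gt_eqF.
rewrite SE (le_trans (ler_norm_sum _ _ _))//.
apply: (@le_trans _ _ (\sum_(t <- S) C * (w t * q.[t ^+ 2]))).
  rewrite big_seq [leRHS]big_seq; apply: ler_sum => t tS.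
  have [wt tr] := Sw t tS; have [q0 qt] := qS t tS.
  rewrite normrM gtr0_norm// [leRHS]mulrCA; apply: ler_wpM2l; first exact: ltW.
  rewrite -[leLHS]mulr1 -qt mulrCA [leRHS]mulrC; apply: ler_wpM2l => //.
  exact: pC.
rewrite -mulr_sumr -SE gauss_jacobi_radial_moment//.
exact: ler_wpM2l.
Qed.

End GaussJacobi.
End PseudoPositiveIntegrals.

(** * Convergence *)

Lemma harmonic_decomposition (R : realType) (d : nat) (a : nat -> nat)
    (Y : forall k : nat, 'I_(a k) -> mpoly.mpoly d R) (P : mpoly.mpoly d R) :
  (0 < d)%N -> orthonormal_harmonic_basis Y ->
  exists (K : nat) (p : forall k : nat, 'I_(a k) -> {poly R}), forall x,
    peval P x =
    \sum_(k < K) \sum_(l < a k) (p k l).[enorm x ^+ 2] * peval (Y k l) x.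
Proof.
move=> d0 hY.
suff [K [p pE]] : exists (K : nat) (p : forall k : nat, 'I_(a k) -> {poly R}),
    forall K', (K <= K')%N -> forall x, peval P x =
    \sum_(k < K') \sum_(l < a k) (p k l).[enorm x ^+ 2] * peval (Y k l) x.
  by exists K, p => x; exact: pE.
move: P; apply: (almansi_ind d0) => [|P Q [K [p pE]] [L [q qE]]|j k H hH].
- exists 0%N, (fun _ _ => 0) => K _ x; rewrite big1 => [|k _].
    by rewrite /peval mpoly.meval0.
  by apply: big1 => l _; rewrite horner0 mul0r.
- exists (maxn K L), (fun k l => p k l + q k l) => K'; rewrite geq_max.
  move=> /andP[KK' LK'] x; rewrite pevalD (pE _ KK') (qE _ LK') -big_split.
  apply: eq_bigr => k _; rewrite -big_split; apply: eq_bigr => l _.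
  by rewrite hornerD mulrDl.
- have [_ /(_ H hH)[c [Hc _]] _] := hY k.
  (* The coefficients are read off as a function on nat to avoid transporting
     along k' = k. *)
  pose cn (i : nat) : R := if insub i is Some l then c ord0 l else 0.
  exists k.+1, (fun k' l => if k' == k then cn l *: 'X^j else 0) => K' kK' x.
  rewrite (bigD1 (Ordinal kK'))//= [X in _ + X]big1 ?addr0; last first.
    move=> k' k'k; apply: big1 => l _.
    have -> : (k' == k :> nat) = false by apply: contraNF k'k => /eqP k'k; apply/eqP/val_inj.
    by rewrite horner0 mul0r.
  rewrite pevalM pevalXn peval_norm_sqr Hc peval_sum mulr_sumr.
  apply: eq_bigr => l _; rewrite eqxx hornerZ hornerXn pevalZ /cn valK.
  by rewrite mulrCA mulrA.
Qed.

Section Convergence.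
Context {R : realType} {d : nat} {a : nat -> nat}.
Variable Y : forall k : nat, 'I_(a k) -> mpoly.mpoly d R.
Hypotheses (d_gt0 : (0 < d)%N) (hY : orthonormal_harmonic_basis Y).
Variables (r : R) (mu : {charge set (borel_rV R d) -> \bar R}).
Hypotheses (r_gt0 : 0 < r) (mu_pos : pseudo_positive Y mu).
Hypothesis mu_supp : measure_support mu `<=` eball r.
Let B : set (borel_rV R d) := eball r.
Let mB : measurable B. Proof. exact: borel_eball. Qed.

Lemma harmonic_moments_bounded :
  (\sum_(0 <= k <oo) \sum_(l < a k)
    (signed_integral mu setT (fun x => peval (Y l) (direction x)))%:E < +oo)%E ->
  exists2 M : R, 0 <= M & forall K, \sum_(k < K) \sum_(l < a k)
    signed_integral mu B (fun x => peval (Y l) (direction x)) <= M.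
Proof.
pose u k := \sum_(l < a k) signed_integral mu B (fun x => peval (Y l) (direction x)).
have u0 k : 0 <= u k.
  by apply: sumr_ge0 => l _; exact: integral_direction_ge0.
have uE k : (\sum_(l < a k) (signed_integral mu setT
    (fun x => peval (Y l) (direction x)))%:E)%E = (u k)%:E.
  rewrite -sumEFin; apply: eq_bigr => l _; congr (EFin _).
  apply: (signed_integral_ball mu_supp).
  apply: (measurableT_comp (continuous_measurable_rV (@continuous_peval _ _ (Y l)))).
  exact: measurable_direction.
under eq_eseriesr do rewrite uE.
move=> sum_lty; set S := (\sum_(0 <= k <oo) (u k)%:E)%E in sum_lty.
have S0 : (0 <= S)%E by apply: nneseries_ge0 => k _ _; rewrite lee_fin.
have Sfin : S \is a fin_num by rewrite ge0_fin_numE.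
exists (fine S) => [|K]; first exact: fine_ge0.
rewrite -lee_fin fineK// -sumEFin -(big_mkord xpredT (fun k => (u k)%:E)).
by apply: nneseries_lim_ge => k _ _; rewrite lee_fin.
Qed.

Lemma gauss_jacobi_uniform_bound (M : R) : 0 <= M ->
  (forall K, \sum_(k < K) \sum_(l < a k)
    signed_integral mu B (fun x => peval (Y l) (direction x)) <= M) ->
  exists2 C : R, 0 <= C & forall s (sigma : {charge set (borel_rV R d) -> \bar R}),
    (0 < s)%N -> gauss_jacobi Y r mu s sigma ->
    forall (P : mpoly.mpoly d R) (b : R), (forall x, B x -> `|peval P x| <= b) ->
    `|signed_integral sigma B (peval P)| <= C * b.
Proof.
move=> M0 hM; have [C C0 hC] := harmonic_coefficient_bound hY.
exists (C * M) => [|s sigma s0 sigma_gj P b Pb]; first exact: mulr_ge0.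
have [K [p pE]] := harmonic_decomposition P d_gt0 hY.
have bm k (l : 'I_(a k)) : bounded_measurable B
    (fun x => (p k l).[enorm x ^+ 2] * peval (Y l) x).
  apply: continuous_bounded_measurable_eball; apply: continuous_mulr.
    exact: continuous_horner_sqr_enorm.
  exact: continuous_peval.
have -> : signed_integral sigma B (peval P) = \sum_(k < K) \sum_(l < a k)
    signed_integral sigma B (fun x => (p k l).[enorm x ^+ 2] * peval (Y l) x).
  under eq_bigr => k _ do rewrite -(signed_integral_sum mB)//.
  rewrite -(signed_integral_sum mB); last by move=> k; exact: bounded_measurable_sum.
  by apply: eq_signed_integral => x _; exact: pE.
have coef k (l : 'I_(a k)) : (k < K)%N ->
    `|signed_integral sigma B (fun x => (p k l).[enorm x ^+ 2] * peval (Y l) x)| <=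
    C * b * signed_integral mu B (fun x => peval (Y l) (direction x)).
  move=> kK; apply: (gauss_jacobi_radial_bound hY r_gt0 s0 mu_pos mu_supp sigma_gj).
  by move=> t tr; apply: (hC K p (peval P) r b) => //; exact: continuous_peval.
have b0 : 0 <= b.
  have B0 : B (0 : 'rV[R]_d).
    by rewrite /B /eball/= (_ : enorm 0 = 0) ?ltW//; apply/eqP; rewrite enorm_eq0.
  exact: le_trans (Pb _ B0).
apply: (@le_trans _ _ (C * b * \sum_(k < K) \sum_(l < a k)
    signed_integral mu B (fun x => peval (Y l) (direction x)))); last first.
  by rewrite [leRHS]mulrAC; apply: ler_wpM2l => //; exact: mulr_ge0.
rewrite mulr_sumr (le_trans (ler_norm_sum _ _ _))//; apply: ler_sum => k _.
rewrite mulr_sumr (le_trans (ler_norm_sum _ _ _))//; apply: ler_sum => l _.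
exact: coef.
Qed.

Variable sigma : nat -> {charge set (borel_rV R d) -> \bar R}.
Hypothesis sigma_gj : forall s, (1 <= s)%N -> gauss_jacobi Y r mu s (sigma s).

Lemma gauss_jacobi_cvg (C : R) (g : 'rV[R]_d -> R) : 0 <= C ->
  (forall s (P : mpoly.mpoly d R) (b : R), (0 < s)%N ->
    (forall x, B x -> `|peval P x| <= b) ->
    `|signed_integral (sigma s) B (peval P)| <= C * b) ->
  {within eball r, continuous g} ->
  signed_integral (sigma s) B g @[s --> \oo] --> signed_integral mu B g.
Proof.
move=> C0 hC cg.
have bg : bounded_measurable B g.
  by apply: continuous_bounded_measurable => //; exact: compact_eball.
have bp (P : mpoly.mpoly d R) : bounded_measurable B (peval P).
  by apply: continuous_bounded_measurable_eball; exact: continuous_peval.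
have approx := weierstrass_approximation (@compact_eball R d r) cg.
have near_peval nu P e : (forall x, B x -> `|g x - peval P x| <= e) ->
    `|signed_integral nu B g - signed_integral nu B (peval P)| <= e * charge_mass B nu.
  move=> gP; rewrite -(signed_integralB mB)//.
  by apply: (normr_signed_integral_le mB) => //; exact: bounded_measurableB.
have close s P e : (0 < s)%N -> 0 < e -> (forall x, B x -> `|g x - peval P x| <= e) ->
    `|signed_integral (sigma s) B g - signed_integral (sigma s) B (peval P)| <= C * (2 * e).
  move=> s0 e0 gP; apply/ler_addgt0Pr => eta eta0.
  have m0 := charge_mass_ge0 B (sigma s).
  pose e1 := Num.min e (eta / (charge_mass B (sigma s) + 1)).
  have e10 : 0 < e1 by rewrite lt_min e0 divr_gt0// ltr_wpDl.
  have [Q gQ] := approx _ e10.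
  have QP : `|signed_integral (sigma s) B (peval (Q - P))| <= C * (2 * e).
    apply: hC => // x Bx; rewrite -scaleN1r pevalD pevalZ mulN1r.
    have -> : peval Q x - peval P x = (g x - peval P x) - (g x - peval Q x) by ring.
    rewrite (le_trans (ler_normB _ _))// mulr2n mulrDl mul1r lerD ?gP//.
    by rewrite (le_trans (gQ _ Bx))// ge_min lexx.
  have gQs := near_peval (sigma s) Q e1 gQ.
  have QPE : signed_integral (sigma s) B (peval (Q - P)) =
      signed_integral (sigma s) B (peval Q) - signed_integral (sigma s) B (peval P).
    rewrite -(signed_integralB mB)//; apply: eq_signed_integral => x _.
    by rewrite -scaleN1r pevalD pevalZ mulN1r.
  rewrite QPE in QP.
  apply: (le_trans (ler_distD (signed_integral (sigma s) B (peval Q)) _ _)).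
  rewrite addrC lerD// (le_trans gQs)//.
  apply: (@le_trans _ _ (eta / (charge_mass B (sigma s) + 1) * (charge_mass B (sigma s) + 1))).
    by apply: ler_pM => //; [exact: ltW|rewrite ge_min lexx orbT|rewrite lerDl].
  by rewrite divfK// gt_eqF// ltr_wpDl.
apply/cvgrPdist_le => e e0.
have m0 := charge_mass_ge0 B mu.
have D0 : 0 < charge_mass B mu + C * 2 + 1 by rewrite ltr_wpDl// addr_ge0// mulr_ge0.
pose e1 := e / (charge_mass B mu + C * 2 + 1).
have e10 : 0 < e1 by rewrite divr_gt0.
have [P gP] := approx _ e10; have [n lapP] := laplacian_nilpotent P.
near=> s.
have s0 : (0 < s)%N by near: s; exact: nbhs_infty_gt.
have ns : (n <= 2 * s)%N.
  apply: (@leq_trans s); [near: s; exact: nbhs_infty_ge|].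
  by rewrite mul2n -addnn leq_addr.
have momentE : signed_integral (sigma s) B (peval P) = signed_integral mu B (peval P).
  apply: (gauss_jacobi_moment mu_supp (sigma_gj s0)).
  by rewrite -(subnK ns) iterD lapP iter_laplacian0.
apply: (le_trans (ler_distD (signed_integral mu B (peval P)) _ _)).
have h1 := near_peval mu P e1 gP.
have h2 := close s P e1 s0 e10 gP; rewrite momentE distrC in h2.
apply: (le_trans (lerD h1 h2)).
have -> : e1 * charge_mass B mu + C * (2 * e1) = e1 * (charge_mass B mu + C * 2) by ring.
rewrite /e1 mulrAC ler_pdivrMr//; apply: ler_wpM2l; first exact: ltW.
by rewrite lerDl.
Unshelve. all: by end_near. Qed.

End Convergence.

Theorem theorem22 (R : realType) (d : nat) (hd : (2 <= d)%N)
    (a : nat -> nat) (Y : forall k : nat, 'I_(a k) -> mpoly.mpoly d R)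
    (hY : orthonormal_harmonic_basis Y)
    (r : R) (hr : 0 < r)
    (mu : {charge set (borel_rV R d) -> \bar R})
    (mu_pos : pseudo_positive Y mu)
    (mu_supp : measure_support mu `<=` eball r)
    (mu_sum : (\sum_(0 <= k <oo) \sum_(l < a k)
                 (signed_integral mu setT
                    (fun x => peval (Y k l) (direction x)))%:E < +oo)%E)
    (sigma : nat -> {charge set (borel_rV R d) -> \bar R})
    (sigma_gj : forall s : nat, (1 <= s)%N -> gauss_jacobi Y r mu s (sigma s))
    (f : 'rV[R]_d -> R[i]^o) (hf : {within eball r, continuous f}) :
  (fun s : nat => complex_integral (signed_integral (sigma s) (eball r)) f
     : R[i]^o) @ \oo -->
  (complex_integral (signed_integral mu (eball r)) f : R[i]^o).
Proof.
have d0 : (0 < d)%N by exact: leq_trans hd.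
have [M M0 hM] := harmonic_moments_bounded hY mu_pos mu_supp mu_sum.
have [C C0 hC] := gauss_jacobi_uniform_bound d0 hY hr mu_pos mu_supp M0 hM.
have hC' s (P : mpoly.mpoly d R) (b : R) : (0 < s)%N ->
    (forall x, eball r x -> `|peval P x| <= b) ->
    `|signed_integral (sigma s) (eball r) (peval P)| <= C * b.
  by move=> s0; apply: (hC s _ s0); exact: sigma_gj.
rewrite /complex_integral; apply: cvg_complex => /=.
  apply: (gauss_jacobi_cvg mu_supp sigma_gj C0 hC').
  by move=> x; apply: cvg_Re; exact: hf.
apply: (gauss_jacobi_cvg mu_supp sigma_gj C0 hC').
by move=> x; apply: cvg_Im; exact: hf.
Qed.
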